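(* Let $V$ and $W$ be vector spaces and $U \subseteq V$ be open. Let $f \colon U \to W$ be a continuous map. Let $a,b \in U$ be such that $a \neq b$ and $[a,b] \subseteq U$. Let $\eta_0 \in W^* \setminus \{0\}$. Then there exists $c$ in the open segment $]a,b[$ such that $$\big(\Lambda_c^{\eta_0}(f)\setminus\{0\}\big) \cap \big(b-a, f(b)-f(a)\big)^\perp \neq \varnothing.$$ In particular, if $f$ is Lipschitz at $c$ for $(b-a)^\perp$, then there exists $\xi_0 \in V^*$ such that $(\xi_0,\eta_0) \in \Lambda_c(f) \cap \big(b-a, f(b)-f(a)\big)^\perp$.
   Context: Vector spaces are real and finite-dimensional. $\Bbbk$ is any fixed nonzero commutative ring of finite global dimension. $[a,b]$ is the line segment from $a$ to $b$ and $]a,b[$ is the segment without its endpoints. For a vector $w$, $w^\perp$ is the set of covectors vanishing on $w$. Microsupport: for a manifold $P$ and $F$ in the bounded derived category $\mathrm{D}^{\mathrm b}(\Bbbk_P)$ of sheaves of $\Bbbk$-modules, $\mathrm{Ppg}(F)$ is the set of $(p,\xi) \in T^*P$ such that for every open neighborhood $U'$ of $p$ and every $\phi \in C^\infty(U')$ with $\phi(p)=0$ and $d\phi(p)=\xi$ one has $(\mathrm{R}\Gamma_{\{\phi \geq 0\}}(F))_p = 0$; the microsupport is $\mu\mathrm{supp}(F) = \overline{T^*P \setminus \mathrm{Ppg}(F)}$. For a locally closed $A \subseteq P$, $\mu\mathrm{supp}(A)$ denotes the microsupport of the constant sheaf on $A$ with stalk $\Bbbk$ extended by zero to $P$. The conormal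 of $f$ is $\Lambda_f = \mu\mathrm{supp}(\Gamma_f) \subseteq T^*(U \times W)$, where $\Gamma_f$ is the graph of $f$. For $c \in U$, $\Lambda_c(f) \subseteq V^* \times W^*$ is its fiber over $(c,f(c))$, and for $\eta \in W^*$, $\Lambda_c^{\eta}(f) = \Lambda_c(f) \cap (V^* \times \mathbb{R}_{\geq 0}\eta)$. For a closed cone $A \subseteq V^*$, $f$ is Lipschitz at $c$ for $A$ if $\Lambda_c(f) \cap (A \times \{0\}) \subseteq \{0\}$. *)

(* Defs.v *)
From HB Require Import structures.
From mathcomp Require Import all_boot all_order all_algebra.
From mathcomp Require Import all_classical all_reals all_analysis.
Set Implicit Arguments.
Unset Strict Implicit.
Unset Printing Implicit Defensive.
Import Order.TTheory GRing.Theory Num.Theory.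
Import numFieldNormedType.Exports.
Local Open Scope classical_set_scope.
Local Open Scope ring_scope.

Definition projective (k : comNzRingType) (M : lmodType k) : Prop :=
  forall (A B : lmodType k) (q : {linear A -> B}) (g : {linear M -> B}),
    (forall b, exists a, q a = b) ->
    exists g' : {linear M -> A}, forall x, q (g' x) = g x.

Definition projdim_le (k : comNzRingType) (n : nat) (M : lmodType k) : Prop :=
  exists (P : nat -> lmodType k) (d : forall i, {linear P i.+1 -> P i})
         (e : {linear P 0%N -> M}),
    [/\ forall i, projective (P i),
        forall i, (n < i)%N -> forall x : P i, x = 0,
        forall m, exists x, e x = m,
        forall x, e x = 0 <-> exists y, d 0%N y = x
      & forall i x, d i x = 0 <-> exists y, d i.+1 y = x].

Definition finite_gldim (k : comNzRingType) : Prop :=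
  exists n : nat, forall M : lmodType k, projdim_le n M.

(* For P open in T, these are exactly the open subsets of the space P. *)
Record opens (T : topologicalType) (P : set T) := Opens {
  oset :> set T;
  open_oset : open oset;
  sub_oset : oset `<=` P }.

Record sheaf (k : comNzRingType) (T : topologicalType) (P : set T) := Sheaf {
  sec : opens P -> lmodType k;
  res : forall O O' : opens P, O' `<=` O -> {linear sec O -> sec O'};
  res_id : forall (O : opens P) (h : O `<=` O) (s : sec O), res h s = s;
  res_comp : forall (O O' O'' : opens P) (h : O' `<=` O) (h' : O'' `<=` O')
    (h'' : O'' `<=` O) (s : sec O), res h' (res h s) = res h'' s;
  res_glue : forall (I : Type) (D : I -> opens P) (O : opens P)
    (hD : forall i, D i `<=` O), (forall x, oset O x -> exists i, oset (D i) x) ->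
    forall s : forall i, sec (D i),
    (forall i j (O' : opens P) (hi : O' `<=` D i) (hj : O' `<=` D j),
       res hi (s i) = res hj (s j)) ->
    exists! t : sec O, forall i, res (hD i) t = s i }.

Arguments res {k T P} _ {O O'}.

Record sheaf_hom (k : comNzRingType) (T : topologicalType) (P : set T)
    (F G : sheaf k P) := SheafHom {
  app :> forall O : opens P, {linear sec F O -> sec G O};
  app_res : forall (O O' : opens P) (h : O' `<=` O) (s : sec F O),
    app O' (res F h s) = res G h (app O s) }.

Section Sheaves.
Variables (k : comNzRingType) (T : topologicalType) (P : set T).
Implicit Types F G H I : sheaf k P.

(* Monomorphisms of sheaves are exactly the sectionwise injective ones. *)
Definition sheaf_mono F G (m : sheaf_hom F G) : Prop :=
  forall O, injective (m O).

Definition injective_sheaf I : Prop :=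
  forall F G (m : sheaf_hom F G) (g : sheaf_hom F I), sheaf_mono m ->
  exists g' : sheaf_hom G I, forall O s, g' O (m O s) = g O s.

(* Exactness of F -> G -> H: a section of G is killed iff it lifts locally. *)
Definition sheaf_exact F G H (f : sheaf_hom F G) (g : sheaf_hom G H) : Prop :=
  forall (O : opens P) (s : sec G O),
    g O s = 0 <->
    forall x, oset O x -> exists (O' : opens P) (h : O' `<=` O),
      oset O' x /\ exists t, f O' t = res G h s.

Record injective_resolution F := InjectiveResolution {
  ires_obj : nat -> sheaf k P;
  ires_d : forall n, sheaf_hom (ires_obj n) (ires_obj n.+1);
  ires_aug : sheaf_hom F (ires_obj 0%N);
  ires_inj : forall n, injective_sheaf (ires_obj n);
  ires_mono : sheaf_mono ires_aug;
  ires_exact0 : sheaf_exact ires_aug (ires_d 0%N);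
  ires_exactS : forall n, sheaf_exact (ires_d n) (ires_d n.+1) }.

(* For Z relatively closed in O this is the support condition of Gamma_Z. *)
Definition supported_in (Z : set T) F (O : opens P) (s : sec F O) : Prop :=
  forall (O' : opens P) (h : O' `<=` O), O' `&` Z = set0 -> res F h s = 0.

Definition is_boundary (Z : set T) F (r : injective_resolution F) (n : nat) :
    forall O : opens P, sec (ires_obj r n) O -> Prop :=
  match n with
  | 0%N => fun O s => s = 0
  | m.+1 => fun O s =>
      exists2 t : sec (ires_obj r m) O, supported_in Z t & ires_d r m O t = s
  end.

(* (RGamma_Z F)_p = 0, for p in the open set N and Z relatively closed in N:
   the stalk at p of Gamma_Z of an injective resolution of F is acyclic.
   All injective resolutions of F are homotopy equivalent, so the condition
   does not depend on the resolution r. *)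
Definition RGamma_stalk_zero (N : opens P) (Z : set T) F (p : T) : Prop :=
  forall (r : injective_resolution F) (n : nat) (O : opens P)
         (s : sec (ires_obj r n) O),
    O `<=` N -> oset O p -> supported_in Z s -> ires_d r n O s = 0 ->
    exists (O' : opens P) (h : O' `<=` O),
      oset O' p /\ is_boundary Z (res (ires_obj r n) h s).

End Sheaves.

Section ConstantSheaf.
Variables (k : comNzRingType) (T : topologicalType) (P A : set T).

(* For A locally closed in P, the sections over O are the locally constant
   functions on O `&` A whose support is closed in O, represented by their
   extension by 0 to T. *)
Definition const_sec_prop (O : opens P) (s : T -> k^o) : Prop :=
  [/\ forall x, ~ (O `&` A) x -> s x = 0,
      forall x, (O `&` A) x -> \forall y \near x, (O `&` A) y -> s y = s x
    & forall x, oset O x -> s x = 0 -> \forall y \near x, s y = 0].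

Definition const_sec_pred (O : opens P) : {pred (T -> k^o)} :=
  fun s => `[< const_sec_prop O s >].

Lemma const_sec_submod (O : opens P) : submod_closed (const_sec_pred O).
Proof.
split=> [|c s t]; rewrite /const_sec_pred !unfold_in.
  by apply/asboolP; split=> // x *; apply: (@filterE _ (nbhs x)).
move=> /asboolP[s0 sc sz] /asboolP[t0 tc tz]; apply/asboolP.
have Ec y : (c *: s + t) y = c * s y + t y by [].
have H x : (O `&` A) x ->
    \forall y \near x, (O `&` A) y -> (c *: s + t) y = (c *: s + t) x.
  move=> xA; have := sc x xA; have := tc x xA.
  apply: (@filterS2 _ (nbhs x)) => y ty sy yA; by rewrite !Ec ty // sy.
split=> [x xA||x xO] //.
  by rewrite Ec s0 // t0 // mulr0 addr0.
have [xA|xA] := pselect (A x).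
  move=> E; apply: (@filterS _ (nbhs x) _ _ _ _ (H x (conj xO xA))) => y Hy.
  have [yA|yA] := pselect ((O `&` A) y); first by rewrite Hy.
  by rewrite Ec s0 // t0 // mulr0 addr0.
move=> _; have nA : ~ (O `&` A) x by case.
have := sz x xO (s0 x nA); have := tz x xO (t0 x nA).
by apply: (@filterS2 _ (nbhs x)) => y ty sy; rewrite Ec ty sy mulr0 addr0.
Qed.

HB.instance Definition _ (O : opens P) :=
  GRing.isSubmodClosed.Build k (T -> k^o) (const_sec_pred O)
    (const_sec_submod O).

Record const_sec (O : opens P) := ConstSec {
  const_fun :> T -> k^o;
  const_funP : const_fun \in const_sec_pred O }.

HB.instance Definition _ (O : opens P) := [isSub for @const_fun O].
HB.instance Definition _ (O : opens P) := [Choice of const_sec O by <:].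
HB.instance Definition _ (O : opens P) :=
  [SubChoice_isSubLmodule of const_sec O by <:].

Lemma const_secP (O : opens P) (s : const_sec O) : const_sec_prop O s.
Proof. exact/asboolP/(const_funP s). Qed.

Lemma const_sec_eq (O : opens P) (s t : const_sec O) :
  (forall x, oset O x -> s x = t x) -> s = t.
Proof.
move=> st; apply/val_inj/funext => x /=.
have [xO|xO] := pselect (oset O x); first exact: st.
by have [s0 _ _] := const_secP s; have [t0 _ _] := const_secP t;
  rewrite s0 ?t0 // => -[].
Qed.

Definition const_res_fun (O' : opens P) (s : T -> k^o) : T -> k^o :=
  fun x => if `[< oset O' x >] then s x else 0.

Lemma const_res_subproof (O O' : opens P) (h : O' `<=` O) (s : const_sec O) :
  const_res_fun O' s \in const_sec_pred O'.
Proof.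
apply/asboolP; have [s0 sc sz] := const_secP s.
have E x : oset O' x -> const_res_fun O' s x = s x.
  by move=> xO; rewrite /const_res_fun asboolT.
split=> [x xA|x [xO xA]|x xO].
- rewrite /const_res_fun; case: asboolP => // xO.
  by apply: s0 => -[_ ?]; apply: xA.
- apply: (@filterS _ (nbhs x) _ _ _ _ (sc x (conj (h _ xO) xA))).
  by move=> y sy [yO yA]; rewrite !E // sy //; split=> //; apply: h.
- rewrite E // => sx0; apply: (@filterS _ (nbhs x) _ _ _ _ (sz x (h _ xO) sx0)).
  by move=> y sy; rewrite /const_res_fun; case: asboolP.
Qed.

Definition const_res (O O' : opens P) (h : O' `<=` O) (s : const_sec O) :
    const_sec O' := ConstSec (const_res_subproof h s).

Lemma const_resE (O O' : opens P) (h : O' `<=` O) (s : const_sec O) x :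
  oset O' x -> const_res h s x = s x.
Proof. by move=> xO; rewrite /= /const_res_fun asboolT. Qed.

Lemma const_res_linear (O O' : opens P) (h : O' `<=` O) :
  linear (const_res h).
Proof.
move=> c s t; apply: const_sec_eq => x xO.
rewrite const_resE //.
change (c * s x + t x = c * const_res h s x + const_res h t x).
by rewrite !const_resE.
Qed.

HB.instance Definition _ (O O' : opens P) (h : O' `<=` O) :=
  GRing.isLinear.Build k (const_sec O) (const_sec O') *:%R (const_res h)
    (const_res_linear h).

Lemma const_glue (I : Type) (D : I -> opens P) (O : opens P)
    (hD : forall i, D i `<=` O) :
  (forall x, oset O x -> exists i, oset (D i) x) ->
  forall s : forall i, const_sec (D i),
  (forall i j (O' : opens P) (hi : O' `<=` D i) (hj : O' `<=` D j),
     const_res hi (s i) = const_res hj (s j)) ->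
  exists! t : const_sec O, forall i, const_res (hD i) t = s i.
Proof.
move=> cov s compat.
have agree i j x : oset (D i) x -> oset (D j) x -> s i x = s j x.
  move=> xi xj.
  have oI : open (D i `&` D j) by apply: openI; apply: open_oset.
  have sI : D i `&` D j `<=` P by move=> y [yi _]; apply: sub_oset yi.
  pose O' := Opens oI sI.
  have hi : O' `<=` D i by move=> y [].
  have hj : O' `<=` D j by move=> y [].
  by rewrite -(const_resE hi) ?(compat i j O' hi hj) ?const_resE.
pose g x : k^o := if pselect (exists i, oset (D i) x) is left e
  then s (projT1 (cid e)) x else 0.
have gE i x : oset (D i) x -> g x = s i x.
  rewrite /g; case: pselect => [e xi|ne xi]; last by case: ne; exists i.
  by case: (cid e) => j xj /=; apply: agree.
have nD i x : oset (D i) x -> \forall y \near x, oset (D i) y.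
  by move=> xi; apply: open_nbhs_nbhs; split => //; apply: open_oset.
have gP : g \in const_sec_pred O.
  apply/asboolP; split=> [x xA|x [xO xA]|x xO].
  - rewrite /g; case: pselect => // e; case: (cid e) => i xi /=.
    have [s0 _ _] := const_secP (s i); apply: s0 => -[_ ?].
    by apply: xA; split=> //; apply: hD xi.
  - have [i xi] := cov x xO; have [_ sc _] := const_secP (s i).
    have := sc x (conj xi xA); have := nD i x xi.
    apply: (@filterS2 _ (nbhs x)) => y yi sy [yO yA].
    by rewrite !(gE i) //; apply: sy.
  - have [i xi] := cov x xO; have [_ _ sz] := const_secP (s i).
    rewrite (gE i) // => /(sz x xi); have := nD i x xi.
    by apply: (@filterS2 _ (nbhs x)) => y yi sy; rewrite (gE i).
exists (ConstSec gP); split=> [i|t tE].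
  by apply: const_sec_eq => x xi; rewrite const_resE //=; apply: gE.
apply: const_sec_eq => x xO; have [i xi] := cov x xO.
by rewrite /= (gE i) // -(tE i) const_resE.
Qed.

Lemma const_res_id (O : opens P) (h : O `<=` O) (s : const_sec O) :
  const_res h s = s.
Proof. by apply: const_sec_eq => x xO; rewrite const_resE. Qed.

Lemma const_res_comp (O O' O'' : opens P) (h : O' `<=` O) (h' : O'' `<=` O')
    (h'' : O'' `<=` O) (s : const_sec O) :
  const_res h' (const_res h s) = const_res h'' s.
Proof.
by apply: const_sec_eq => x xO; rewrite !const_resE //; apply: h'.
Qed.

Definition const_sheaf : sheaf k P :=
  @Sheaf k T P (fun O => const_sec O : lmodType k)
    (fun O O' h => const_res h) const_res_id const_res_comp const_glue.

End ConstantSheaf.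

(* The norm only provides the topology, which in finite dimension does not
   depend on it. *)
Definition finite_dim (R : realType) (E : normedModType R) : Prop :=
  exists (n : nat) (g : {linear 'rV[R]_n -> E}), bijective g.

Definition dual (R : realType) (E : normedModType R) := {linear E -> R^o}.

(* All iterated directional derivatives of phi exist and are Frechet
   differentiable, hence continuous, on N. *)
Definition smooth_on (R : realType) (E : normedModType R) (N : set E)
    (phi : E -> R^o) : Prop :=
  forall (vs : seq E) (x : E), N x ->
    differentiable (foldr (fun v (g : E -> R^o) => 'D_v g) phi vs) x.

Section Microsupport.
Variables (k : comNzRingType) (R : realType) (E : normedModType R) (P : set E).

Definition propagates (F : sheaf k P) (p : E) (xi : dual E) : Prop :=
  forall (N : opens P) (phi : E -> R^o),
    oset N p -> smooth_on N phi -> phi p = 0 -> 'd phi p =1 xi ->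
    RGamma_stalk_zero N (N `&` [set q | 0 <= phi q]) F p.

(* The closure is taken in P x E^*; for finite-dimensional E the topology of
   E^* is given by the operator norm. *)
Definition microsupport (F : sheaf k P) : set (E * dual E) :=
  [set z : E * dual E | P z.1 /\ forall e : R, 0 < e ->
    exists (q : E) (zeta : dual E),
      [/\ P q, ~ propagates F q zeta, `|q - z.1| < e
        & forall v, `|zeta v - z.2 v| <= e * `|v|]].

Definition microsupport_set (A : set E) : set (E * dual E) :=
  microsupport (const_sheaf k P A).

End Microsupport.

(* Only the values of f on U are used. *)
Section Conormal.
Variables (k : comNzRingType) (R : realType) (V W : normedModType R).
Variables (U : set V) (f : V -> W).

Definition graph_on : set (V * W) := [set z : V * W | U z.1 /\ z.2 = f z.1].

Definition conormal : set ((V * W) * dual (V * W)%type) :=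
  microsupport_set k (U `*` setT) graph_on.

Definition dual_pair_fun (xi : dual V) (eta : dual W) (z : V * W) : R^o :=
  xi z.1 + eta z.2.

Lemma dual_pair_linear (xi : dual V) (eta : dual W) :
  linear (dual_pair_fun xi eta).
Proof.
by move=> a u v; rewrite /dual_pair_fun !linearP scalerDr addrACA.
Qed.

HB.instance Definition _ (xi : dual V) (eta : dual W) :=
  GRing.isLinear.Build R (V * W)%type R^o *:%R (dual_pair_fun xi eta)
    (dual_pair_linear xi eta).

Definition dual_pair (xi : dual V) (eta : dual W) : dual (V * W)%type :=
  dual_pair_fun xi eta.

Definition conormal_at (c : V) : set (dual V * dual W) :=
  [set z : dual V * dual W | conormal ((c, f c), dual_pair z.1 z.2)].

Definition conormal_at_dir (c : V) (eta : dual W) : set (dual V * dual W) :=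
  conormal_at c `&`
    [set z : dual V * dual W | exists2 s : R, 0 <= s & forall w, z.2 w = s * eta w].

Definition zero_covector : set (dual V * dual W) :=
  [set z : dual V * dual W | (forall v, z.1 v = 0) /\ (forall w, z.2 w = 0)].

Definition lipschitz_at_for (A : set (dual V)) (c : V) : Prop :=
  conormal_at c `&` [set z : dual V * dual W | A z.1 /\ forall w, z.2 w = 0]
    `<=` zero_covector.

End Conormal.

Definition annihilator (R : realType) (E : normedModType R) (w : E) :
  set (dual E) := [set xi : dual E | xi w = 0].

Definition annihilator_pair (R : realType) (V W : normedModType R)
    (v : V) (w : W) : set (dual V * dual W) :=
  [set z : dual V * dual W | annihilator (v, w) (dual_pair z.1 z.2)].

Definition segment (R : realType) (E : lmodType R) (a b : E) : set E :=
  [set a + t *: (b - a) | t in [set t : R | 0 <= t <= 1]].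

Definition open_segment (R : realType) (E : lmodType R) (a b : E) : set E :=
  [set a + t *: (b - a) | t in [set t : R | 0 < t < 1]].

(* Main.v *)
Require Import Defs.
From HB Require Import structures.
From mathcomp Require Import all_boot all_order all_algebra.
From mathcomp Require Import all_classical all_reals all_analysis.
From mathcomp Require Import ring lra.
Set Implicit Arguments.
Unset Strict Implicit.
Unset Printing Implicit Defensive.
Import Order.TTheory GRing.Theory Num.Theory.
Import numFieldNormedType.Exports.
Local Open Scope classical_set_scope.
Local Open Scope ring_scope.

(** Put v = b - a and m = eta0 (f b - f a). The function
    h(t) = eta0 (f (a + t v)) - eta0 (f a) - t m vanishes at t = 0 and t = 1, so it
    has an interior minimum or a positive interior maximum. Test functions on the
    product are taken of the form phi(y, w) = eta0 w + N D(y) + B(L y), where L is a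
    linear coordinate along the line, D is a squared distance to the line and B is a
    function of one variable. Because D is constant along the line, d phi takes the
    value B' + m on (v, f b - f a), whatever the size of the penalty N. The aim is to
    find, arbitrarily close to a compact part of the open segment, points of the graph
    where such a phi violates propagation and B' + m is arbitrarily small
    ([approximate_critical_points]). The covectors (d (N D + B o L), eta0) may be
    unbounded, but after normalization they accumulate at a nonzero covector
    (xi, s eta0) with s >= 0 that vanishes on (v, f b - f a) ([conormal_limit]). When f
    is Lipschitz for the annihilator of v, the case s = 0 is excluded, and one divides
    by s, since the microsupport is a cone ([microsupport_scale]).

    Propagation is used only through cohomology in degrees 0 and 1. In degree 0 it
    says that phi has no local minimum on the graph ([propagates_near]). In degree 1
    it says that a locally constant function on the part of the graph where phi < 0
    extends to the graph near the point ([propagates_extension]); as the graph is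
    locally connected, the region phi < 0 cannot approach the point from two separated
    sides ([graph_propagates_side]). An interior minimum of h violates the first
    property at a minimum of phi over a thin tube around the segment ([approx_min]). A
    positive maximum of h is a mountain pass: in a thin tube, the two ends of the
    segment are separated in the sublevel set just below the maximum and connected
    just above it, and at the level where they first become connected one of the two
    properties fails at some point ([mountain_pass], [approx_max]). To keep the ends of
    the sublevel sets from moving, the level is raised only over a smooth bump with
    support inside the segment.

    The definition of propagation quantifies over injective resolutions, so one must
    exist. It is built from characters: Q/Z is an injective cogenerator of abelian
    groups ([divisible_extension], [QmodZ_separates]), hence Hom_Z(k, Q/Z) is an
    injective k-module, and products of skyscraper sheaves with this value are
    injective ([psheaf_injective]). Mapping a sheaf B to the product over all
    characters of its stalks that vanish on the image of A -> B gives a map whose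
    kernel is exactly that image ([step_exact]), and iterating this step yields a
    resolution with flabby terms ([char_resolution]). *)

(** * Divisible groups *)

Section Divisible.
Variables (M D : zmodType).

Definition divisible := forall (n : nat) (d : D), exists d', d' *+ n.+1 = d.

(** The graph of a homomorphism from a subgroup of [M] to [D]. *)
Definition additive_graph (G : set (M * D)) : Prop :=
  [/\ G (0, 0), forall u v, G u -> G v -> G (u - v)
    & forall d, G (0, d) -> d = 0].

Section Graph.
Variables (G : set (M * D)) (gG : additive_graph G).

Lemma graphN u : G u -> G (- u).
Proof. by case: gG => G0 GB _ Gu; rewrite -sub0r; apply: GB. Qed.

Lemma graphD u v : G u -> G v -> G (u + v).
Proof. by move=> Gu Gv; case: gG => _ GB _; rewrite -[v]opprK; apply/GB/graphN. Qed.

Lemma graphMn n u : G u -> G (u *+ n).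
Proof.
by move=> Gu; elim: n => [|n IH]; [case: gG | rewrite mulrS; apply: graphD].
Qed.

Lemma graphMz (n : int) u : G u -> G (u *~ n).
Proof. by case: n => n Gu; [|rewrite NegzE mulrNz; apply: graphN]; apply: graphMn. Qed.

Lemma graph_fun m d d' : G (m, d) -> G (m, d') -> d = d'.
Proof.
move=> Gd Gd'; case: gG => _ GB G0; apply/subr0_eq/G0.
by have := GB _ _ Gd Gd'; rewrite -[X in G X]/(m - m, d - d') subrr.
Qed.

End Graph.

Lemma pair_mulrz (m : M) (d : D) (n : int) : (m, d) *~ n = (m *~ n, d *~ n).
Proof.
have E k : (m, d) *+ k = (m *+ k, d *+ k).
  by elim: k => [|k IH]; rewrite ?mulr0n ?mulrS // IH.
by case: n => n; rewrite ?NegzE ?mulrNz -?pmulrn E.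
Qed.

Hypothesis divD : divisible.

(** The value at the new element [m] is constrained only through the multiples
    of [m] that already have one; these are the multiples of the smallest
    positive one, so a single division in [D] settles all constraints. *)
Lemma graph_adjoin_value (G : set (M * D)) (m : M) : additive_graph G ->
  exists d, forall (n : int) c, G (m *~ n, c) -> c = d *~ n.
Proof.
move=> gG; have [[n [c Gc]]|noG] := pselect (exists n c, G (m *+ n.+1, c)); last first.
  exists 0 => n c; rewrite mul0rz; case: n => [[|n]|n] Gc.
  - by case: gG => _ _; apply.
  - by case: noG; exists n, c.
  - case: noG; exists n, (- c).
    by have : G (- (m *~ Negz n), - c) := graphN gG Gc; rewrite NegzE mulrNz opprK.
pose P n := `[< exists c, G (m *+ n.+1, c) >].
have exP : exists n, P n by exists n; apply/asboolP; exists c.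
case: (ex_minnP exP) => k /asboolP[e Ge] kmin.
have [d dE] := divD k e; exists d => z b Gb.
have [q [r [zE rk]]] : exists (q : int) (r : nat),
    z = q * k.+1%:Z + r%:Z /\ (r < k.+1)%N.
  exists (z %/ k.+1%:Z)%Z; exists `|(z %% k.+1%:Z)%Z|%N.
  rewrite gez0_abs ?modz_ge0 // -divz_eq; split=> //.
  by rewrite -ltz_nat gez0_abs ?modz_ge0 // ltz_mod.
subst z.
have Gr : G (m *+ r, b - e *~ q).
  have := (graphD gG) _ _ Gb (graphN gG (graphMz gG q Ge)).
  rewrite pair_mulrz -[X in G X]/((_ - _), (_ - _)) mulrzDr.
  by rewrite [q * _]mulrC mulrzA -!pmulrn addrAC subrr add0r.
clear Gb; case: r rk Gr => [|r] rk Gr; last first.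
  by have := kmin r (asboolT (ex_intro _ _ Gr)); rewrite leqNgt -ltnS rk.
rewrite mulr0n in Gr; case: gG => _ _ /(_ _ Gr)/subr0_eq ->.
by rewrite addr0 mulrC mulrzA -pmulrn dE.
Qed.

(** A pair belongs to the enlarged graph when subtracting a multiple of [(m, d)]
    brings it into [G]. *)
Lemma graph_adjoin (G : set (M * D)) (m : M) : additive_graph G ->
  exists G', [/\ additive_graph G', G `<=` G' & exists d, G' (m, d)].
Proof.
move=> gG; have [d dP] := graph_adjoin_value m gG; have [G0 GB Gf] := gG.
exists [set u | exists n : int, G (u - (m, d) *~ n)]; split.
- split=> [|u v [n Gn] [l Gl]|c [n]].
  + by exists 0; rewrite mulr0z subr0.
  + exists (n - l).
    suff -> : u - v - (m, d) *~ (n - l) = (u - (m, d) *~ n) - (v - (m, d) *~ l).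
      exact: GB.
    by rewrite mulrzBr !opprB addrACA [RHS]addrACA [- v - _]addrC.
  + rewrite pair_mulrz -[X in G X]/(0 - m *~ n, c - d *~ n) sub0r -mulrNz.
    by move/dP; rewrite mulrNz -[RHS]sub0r => /addIr.
- by move=> u Gu; exists 0; rewrite mulr0z subr0.
- by exists d, 1; rewrite mulr1z subrr.
Qed.

(** Divisible groups are injective; the graph formulation covers both the
    extension of a homomorphism along a monomorphism and the construction of a
    homomorphism with prescribed values. *)
Lemma divisible_extension (G : set (M * D)) : additive_graph G ->
  exists mu : {additive M -> D}, forall m d, G (m, d) -> mu m = d.
Proof.
move=> gG.
(* Taking the union with [G] makes the empty chain harmless. *)
have [F totF FP|A [gA maxA]] :=
    @Zorn_bigcup (M * D)%type [set X | additive_graph (X `|` G)].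
  split=> [|u v|d].
  - by right; case: gG.
  - move=> [[X FX Xu]|Gu] [[Y FY Yv]|Gv].
    + have [XY|YX] := FP _ _ FX FY.
      * have [_ GB _] := totF _ FY.
        by have [?|?] := GB u v (or_introl (XY _ Xu)) (or_introl Yv); [left; exists Y|right].
      * have [_ GB _] := totF _ FX.
        by have [?|?] := GB u v (or_introl Xu) (or_introl (YX _ Yv)); [left; exists X|right].
    + have [_ GB _] := totF _ FX.
      by have [?|?] := GB u v (or_introl Xu) (or_intror Gv); [left; exists X|right].
    + have [_ GB _] := totF _ FY.
      by have [?|?] := GB u v (or_intror Gu) (or_introl Yv); [left; exists Y|right].
    + by right; case: gG => _ GB _; apply: GB.
  - move=> [[X FX X0]|G0]; last by case: gG => _ _; apply.
    by have [_ _] := totF _ FX; apply; left.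
have tot m : exists d, (A `|` G) (m, d).
  have [B [gB AB [d Bd]]] := graph_adjoin m gA.
  have BG : B `|` G = B.
    by apply/seteqP; split=> [u [//|Gu]|u]; [apply: AB; right | left].
  have [BA|nBA] := pselect (B `<=` A); first by exists d; left; apply: BA.
  have := maxA B; case; last by rewrite /= BG.
  by split=> // u Au; apply: AB; left.
pose mu m := sval (cid (tot m)).
have muP m : (A `|` G) (m, mu m) by rewrite /mu; case: cid.
have mu_additive : zmod_morphism mu.
  move=> m n; apply: (graph_fun gA (muP _)); have [_ GB _] := gA.
  exact: (GB _ _ (muP m) (muP n)).
pose muA := GRing.isZmodMorphism.Build M D mu mu_additive.
pose mu' : {additive M -> D} := HB.pack mu muA.
by exists mu' => m d Gd; apply: (graph_fun gA (muP m)); right.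
Qed.

End Divisible.

Definition QmodZ : zmodType := 
  Quotient.quot [the zmodClosed rat of (@Num.int_num_subdef rat : {pred rat})].

Definition to_QmodZ (x : rat) : QmodZ := (\pi_QmodZ x)%qT.

Lemma to_QmodZ_additive : zmod_morphism to_QmodZ.
Proof. exact: pi_is_zmod_morphism. Qed.

HB.instance Definition _ :=
  GRing.isZmodMorphism.Build rat QmodZ to_QmodZ to_QmodZ_additive.

Lemma to_QmodZ_eq0 x : (to_QmodZ x == 0) = (x \is a Num.int).
Proof.
by rewrite -(raddf0 to_QmodZ) /to_QmodZ -Quotient.idealrBE subr0.
Qed.

Lemma divisible_QmodZ : divisible QmodZ.
Proof.
move=> n d; exists (to_QmodZ (repr d / n.+1%:R)).
rewrite -(raddfMn to_QmodZ) -(mulr_natr (_ / _)) divfK ?pnatr_eq0 //; apply: reprK.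
Qed.

Definition subgroup (M : zmodType) (S : set M) : Prop :=
  S 0 /\ forall u v, S u -> S v -> S (u - v).

Lemma subgroupN (M : zmodType) (S : set M) u : subgroup S -> S u -> S (- u).
Proof. by case=> S0 SB Su; rewrite -sub0r; apply: SB. Qed.

Lemma subgroupMz (M : zmodType) (S : set M) u (n : int) :
  subgroup S -> S u -> S (u *~ n).
Proof.
move=> gS Su; have Sn k : S (u *+ k).
  elim: k => [|k IH]; first by case: gS.
  by rewrite mulrSr -[X in _ + X]opprK; case: (gS) => _; apply=> //; exact: subgroupN.
by case: n => n; rewrite ?NegzE ?mulrNz -?pmulrn //; apply: subgroupN.
Qed.

(** The annihilator of [m] in M/S is a proper ideal of Z; it also kills 1/N when
    it is generated by N > 0, and 1/2 when it is zero. *)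
Lemma QmodZ_order (M : zmodType) (S : set M) (m : M) : subgroup S -> ~ S m ->
  exists2 d : QmodZ, d <> 0 & forall n : int, S (m *~ n) -> d *~ n = 0.
Proof.
move=> gS Sm; have [tors|free] := pselect (exists n, S (m *+ n.+1)); last first.
  exists (to_QmodZ 2^-1); first by move/eqP; rewrite to_QmodZ_eq0.
  case=> [[|n]|n] mn; first by rewrite mulr0z.
  - by case: free; exists n.
  - by case: free; exists n; rewrite -[_ *+ _]opprK; apply: subgroupN.
have exP : exists n, `[< S (m *+ n.+1) >].
  by case: tors => n Sn; exists n; apply/asboolP.
have [N /asboolP SN Nmin] := ex_minnP exP.
exists (to_QmodZ N.+1%:R^-1) => [/eqP|z mz].
  rewrite to_QmodZ_eq0; case: N SN {Nmin} => [//|N] _.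
  move=> /intrP[z zE]; have: 0 < (z%:~R : rat) < 1.
    by rewrite -zE invr_gt0 ltr0n invf_lt1 ?ltr0n // ltr1n.
  by rewrite ltr0z ltrz1; case: z {zE} => [[]|].
apply/eqP; rewrite -raddfMz to_QmodZ_eq0 -mulrzl.
have : S (m *~ (z %% N.+1%:Z)%Z).
  rewrite /modz mulrzBr; case: (gS) => _; apply=> //.
  by rewrite mulrC mulrzA -pmulrn; apply: subgroupMz.
have r0 : (0 <= (z %% N.+1%:Z)%Z) by rewrite modz_ge0.
have rN : (z %% N.+1%:Z)%Z < N.+1%:Z by rewrite ltz_mod.
rewrite {2}(divz_eq z N.+1%:Z); move: r0 rN; case: (z %% _)%Z => // -[|r] _ rN mr.
  by rewrite addr0 intrM -pmulrn mulfK ?pnatr_eq0 // intr_int.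
by have := Nmin r (asboolT mr); rewrite leqNgt -ltnS -ltz_nat rN.
Qed.

(** Q/Z cogenerates: homomorphisms to it separate points from subgroups. *)
Lemma QmodZ_separates (M : zmodType) (S : set M) (m : M) : subgroup S -> ~ S m ->
  exists mu : {additive M -> QmodZ}, (forall u, S u -> mu u = 0) /\ mu m <> 0.
Proof.
move=> gS Sm; have [d d0 dP] := QmodZ_order gS Sm; have [S0 SB] := gS.
pose G := [set u : M * QmodZ | exists2 n : int, S (u.1 - m *~ n) & u.2 = d *~ n].
have gG : additive_graph G.
  split=> [|u v [n Sn un] [l Sl vl]|c [n /= Sn ->]].
  - by exists 0; rewrite ?mulr0z ?subr0.
  - exists (n - l); last by rewrite mulrzBr -un -vl.
    suff -> : (u - v).1 - m *~ (n - l) = (u.1 - m *~ n) - (v.1 - m *~ l).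
      exact: SB.
    by rewrite mulrzBr !opprB addrACA [RHS]addrACA [- v.1 - _]addrC.
  - by rewrite sub0r in Sn; apply: dP; rewrite -[_ *~ _]opprK; apply: subgroupN.
have [mu muG] := divisible_extension divisible_QmodZ gG.
exists mu; split=> [u Su|].
  by apply: muG; exists 0; rewrite /= mulr0z // subr0.
by rewrite (muG m d) //; exists 1; rewrite /= mulr1z // subrr.
Qed.
(** * Stalks *)

Section Stalk.
Local Open Scope quotient_scope.
Variables (k : comNzRingType) (T : topologicalType) (P : set T).
Implicit Types F G : sheaf k P.

(** A point of the interior of [P]; the chosen neighborhood provides the zero
    germ. *)
Record stalk_point := StalkPoint { pt : T; pt_open : opens P; pt_mem : oset pt_open pt }.

Definition meet (O O' : opens P) : opens P :=
  @Opens _ P (O `&` O') (openI (open_oset O) (open_oset O'))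
    (fun x h => @sub_oset _ _ O x h.1).

Lemma meetl (O O' : opens P) : meet O O' `<=` O. Proof. by move=> x []. Qed.
Lemma meetr (O O' : opens P) : meet O O' `<=` O'. Proof. by move=> x []. Qed.

Section Germ.
Variables (F : sheaf k P) (x : stalk_point).

Record pregerm := Pregerm {
  pg_open : opens P; pg_mem : oset pg_open (pt x); pg_sec : sec F pg_open }.

HB.instance Definition _ := gen_eqMixin pregerm.
HB.instance Definition _ := gen_choiceMixin pregerm.

Definition same_germ (u v : pregerm) : Prop :=
  exists (O : opens P) (hu : O `<=` pg_open u) (hv : O `<=` pg_open v),
    oset O (pt x) /\ res F hu (pg_sec u) = res F hv (pg_sec v).

Definition same_germb u v := `[< same_germ u v >].

Lemma same_germ_equiv : equiv_class_of same_germb.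
Proof.
have sym u v : same_germ u v -> same_germ v u.
  by move=> [ O [hu [hv [xO e]]]]; exists O, hv, hu.
split=> [u|u v|v u w].
- by apply/asboolP; exists (pg_open u), (@subset_refl _ _), (@subset_refl _ _);
    split=> //; apply: pg_mem.
- by apply/asboolP/asboolP; apply: sym.
- move=> /asboolP[ O [hu [hv [xO e]]]] /asboolP[ O' [hv' [hw [xO' e']]]].
  apply/asboolP; exists (meet O O'), (subset_trans (@meetl O O') hu),
    (subset_trans (@meetr O O') hw); split=> //.
  rewrite -(res_comp hu (@meetl O O')) e (res_comp _ _ (subset_trans (@meetl O O') hv)).
  by rewrite -(res_comp hw (@meetr O O')) -e' (res_comp _ _ (subset_trans (@meetl O O') hv)).
Qed.

Canonical same_germ_equivRel := EquivRelPack same_germ_equiv.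
Canonical same_germ_encModRel := defaultEncModRel same_germb.

Definition stalk := {eq_quot same_germb}.
HB.instance Definition _ := EqQuotient.on stalk.
HB.instance Definition _ := Choice.on stalk.

Definition germ_at (O : opens P) (xO : oset O (pt x)) (s : sec F O) : stalk :=
  \pi_stalk (Pregerm xO s).

Lemma germ_atP (u : stalk) :
  exists (O : opens P) (xO : oset O (pt x)) (s : sec F O), u = germ_at xO s.
Proof.
by exists (pg_open (repr u)), (pg_mem (repr u)), (pg_sec (repr u));
   rewrite /germ_at -[LHS]reprK; congr (\pi _); case: (repr u).
Qed.

Lemma germ_at_eq (O O' : opens P) (xO : oset O (pt x)) (xO' : oset O' (pt x)) s t :
  germ_at xO s = germ_at xO' t <->
  exists (O'' : opens P) (h : O'' `<=` O) (h' : O'' `<=` O'),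
    oset O'' (pt x) /\ res F h s = res F h' t.
Proof.
split=> [/eqmodP/asboolP[ O'' [h [h' e]]]|[ O'' [h [h' e]]]].
  by exists O'', h, h'.
by apply/eqmodP/asboolP; exists O'', h, h'.
Qed.

Lemma germ_at_res (O O' : opens P) (xO : oset O (pt x)) (xO' : oset O' (pt x))
  (h : O' `<=` O) s : germ_at xO' (res F h s) = germ_at xO s.
Proof.
apply/germ_at_eq; exists O', (@subset_refl _ _), h; split=> //.
by rewrite res_id.
Qed.

Definition stalk_zero : stalk := germ_at (pt_mem x) 0.

Definition stalk_opp (u : stalk) : stalk :=
  germ_at (pg_mem (repr u)) (- pg_sec (repr u)).

Definition stalk_add (u v : stalk) : stalk :=
  germ_at (O := meet (pg_open (repr u)) (pg_open (repr v)))
    (conj (pg_mem (repr u)) (pg_mem (repr v)))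
    (res F (@meetl _ _) (pg_sec (repr u)) + res F (@meetr _ _) (pg_sec (repr v))).

Lemma stalk_addE (O : opens P) (xO : oset O (pt x)) s t :
  stalk_add (germ_at xO s) (germ_at xO t) = germ_at xO (s + t).
Proof.
rewrite /stalk_add.
set u := repr (germ_at xO s); set v := repr (germ_at xO t).
have /germ_at_eq[ O1 [h1 [h1' [x1 e1]]]] : germ_at (pg_mem u) (pg_sec u) = germ_at xO s.
  by rewrite -[RHS]reprK -/u /germ_at; congr (\pi _); case: (u).
have /germ_at_eq[ O2 [h2 [h2' [x2 e2]]]] : germ_at (pg_mem v) (pg_sec v) = germ_at xO t.
  by rewrite -[RHS]reprK -/v /germ_at; congr (\pi _); case: (v).
apply/germ_at_eq; exists (meet O1 O2).
have h : meet O1 O2 `<=` meet (pg_open u) (pg_open v).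
  by move=> y [y1 y2]; split; [exact: h1 y1 | exact: h2 y2].
exists h, (subset_trans (@meetl O1 O2) h1'); split=> //.
rewrite !raddfD /= (res_comp _ h (subset_trans (@meetl O1 O2) h1)).
rewrite (res_comp _ h (subset_trans (@meetr O1 O2) h2)).
rewrite -(res_comp h1 (@meetl O1 O2)) e1 -(res_comp h2 (@meetr O1 O2)) e2.
rewrite (res_comp _ _ (subset_trans (@meetl O1 O2) h1')).
by rewrite (res_comp _ _ (subset_trans (@meetl O1 O2) h1')).
Qed.

Lemma stalk_oppE (O : opens P) (xO : oset O (pt x)) s :
  stalk_opp (germ_at xO s) = germ_at xO (- s).
Proof.
rewrite /stalk_opp; set u := repr (germ_at xO s).
have /germ_at_eq[ O1 [h1 [h1' [x1 e1]]]] : germ_at (pg_mem u) (pg_sec u) = germ_at xO s.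
  by rewrite -[RHS]reprK -/u /germ_at; congr (\pi _); case: (u).
by apply/germ_at_eq; exists O1, h1, h1'; split=> //; rewrite !raddfN /= e1.
Qed.

Lemma stalk_zeroE (O : opens P) (xO : oset O (pt x)) : stalk_zero = germ_at xO 0.
Proof.
by apply/germ_at_eq; exists (meet (pt_open x) O), (@meetl _ _), (@meetr _ _);
   split; [split=> //; apply: pt_mem | rewrite !raddf0].
Qed.

(** Finitely many germs are represented over one open set, which reduces the group
    axioms to those of sections. *)
Lemma germ_at_common (u v w : stalk) :
  exists (O : opens P) (xO : oset O (pt x)) (s t r : sec F O),
    [/\ u = germ_at xO s, v = germ_at xO t & w = germ_at xO r].
Proof.
have [ O1 [x1 [s ->]]] := germ_atP u; have [ O2 [x2 [t ->]]] := germ_atP v.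
have [ O3 [x3 [r ->]]] := germ_atP w.
have x123 : oset (meet O1 (meet O2 O3)) (pt x) by [].
exists _, x123, (res F (@meetl _ _) s),
  (res F (subset_trans (@meetr _ _) (@meetl _ _)) t),
  (res F (subset_trans (@meetr _ _) (@meetr _ _)) r).
by split; rewrite germ_at_res.
Qed.

Lemma stalk_addA : associative stalk_add.
Proof.
by move=> u v w; have [ O [xO [s [t [r [-> -> ->]]]]]] := germ_at_common u v w;
   rewrite !stalk_addE addrA.
Qed.

Lemma stalk_addC : commutative stalk_add.
Proof.
by move=> u v; have [ O [xO [s [t [r [-> -> _]]]]]] := germ_at_common u v v;
   rewrite !stalk_addE addrC.
Qed.

Lemma stalk_add0 : left_id stalk_zero stalk_add.
Proof.
by move=> u; have [ O [xO [s ->]]] := germ_atP u;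
   rewrite (stalk_zeroE xO) stalk_addE add0r.
Qed.

Lemma stalk_addN : left_inverse stalk_zero stalk_opp stalk_add.
Proof.
by move=> u; have [ O [xO [s ->]]] := germ_atP u;
   rewrite stalk_oppE stalk_addE addNr (stalk_zeroE xO).
Qed.

HB.instance Definition _ :=
  GRing.isZmodule.Build stalk stalk_addA stalk_addC stalk_add0 stalk_addN.

(** The germ map, extended by zero to the open sets that miss the point: it is
    then additive on sections over every open set. *)
Definition germ (O : opens P) (s : sec F O) : stalk :=
  if pselect (oset O (pt x)) is left xO then germ_at xO s else 0.

Lemma germE (O : opens P) (xO : oset O (pt x)) s : germ s = germ_at xO s.
Proof.
by rewrite /germ; case: pselect => // xO'; rewrite (Prop_irrelevance xO' xO).
Qed.

Lemma germ_out (O : opens P) (s : sec F O) : ~ oset O (pt x) -> germ s = 0.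
Proof. by rewrite /germ; case: pselect. Qed.

Lemma germ_additive (O : opens P) : zmod_morphism (@germ O).
Proof.
move=> s t; have [xO|xO] := pselect (oset O (pt x)); last by rewrite !germ_out ?subr0.
by rewrite !(germE xO) -stalk_addE -stalk_oppE.
Qed.

HB.instance Definition _ (O : opens P) :=
  GRing.isZmodMorphism.Build (sec F O) stalk (@germ O) (@germ_additive O).

Lemma germ_eq (O O' : opens P) (s : sec F O) (t : sec F O') :
  oset O (pt x) -> oset O' (pt x) -> germ s = germ t ->
  exists (O'' : opens P) (h : O'' `<=` O) (h' : O'' `<=` O'),
    oset O'' (pt x) /\ res F h s = res F h' t.
Proof.
by move=> xO xO'; rewrite (germE xO) (germE xO'); exact: (germ_at_eq _ _ _ _).1.
Qed.

Lemma germ_res (O O' : opens P) (h : O' `<=` O) (s : sec F O) :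
  oset O' (pt x) -> germ (res F h s) = germ s.
Proof. by move=> xO'; rewrite (germE xO') (germE (h _ xO')); exact: germ_at_res. Qed.

End Germ.

End Stalk.
(** * Coinduced modules and products of skyscraper sheaves *)

Section Coinduced.
Variable k : comNzRingType.

Definition coind_pred : {pred k -> QmodZ} := fun c => `[< zmod_morphism c >].

Lemma coind_zmod_closed : zmod_closed coind_pred.
Proof.
split=> [|c e /asboolP cA /asboolP eA]; apply/asboolP => a b.
  by rewrite /= subr0.
rewrite -[LHS]/(c (a - b) - e (a - b)) -[RHS]/((c a - e a) - (c b - e b)).
by rewrite cA eA !opprB addrACA [RHS]addrACA [- c b - _]addrC.
Qed.

HB.instance Definition _ :=
  GRing.isZmodClosed.Build (k -> QmodZ) coind_pred coind_zmod_closed.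

(** Hom_Z(k, Q/Z) with k acting on the source: k-linear maps into it are the
    additive maps into Q/Z, so it inherits injectivity from Q/Z. *)
Record coind := Coind { coind_fun :> k -> QmodZ; coindP : coind_fun \in coind_pred }.

HB.instance Definition _ := [isSub for coind_fun].
HB.instance Definition _ := [Choice of coind by <:].
HB.instance Definition _ := [SubChoice_isSubZmodule of coind by <:].

Lemma coind_eq (c e : coind) : (forall a, c a = e a) -> c = e.
Proof. by move=> ce; apply/val_inj/funext. Qed.

Lemma coindB (c : coind) a b : c (a - b) = c a - c b.
Proof. by have /asboolP := coindP c; apply. Qed.

Lemma coindD (c : coind) a b : c (a + b) = c a + c b.
Proof.
have c0 : c 0 = 0 by have := coindB c 0 0; rewrite !subrr.
by rewrite -[b in LHS]opprK coindB -[- b]sub0r coindB c0 sub0r opprK.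
Qed.

Lemma coind_scale_subproof (b : k) (c : coind) :
  (fun a => c (a * b)) \in coind_pred.
Proof. by apply/asboolP => a a'; rewrite mulrBl coindB. Qed.

Definition coind_scale b c := Coind (coind_scale_subproof b c).

Lemma coind_scaleA a b c : coind_scale a (coind_scale b c) = coind_scale (a * b) c.
Proof. by apply: coind_eq => x /=; rewrite mulrA. Qed.

Lemma coind_scale1 : left_id 1 coind_scale.
Proof. by move=> c; apply: coind_eq => x /=; rewrite mulr1. Qed.

Lemma coind_scaleDr : right_distributive coind_scale +%R.
Proof. by move=> a c e; apply: coind_eq. Qed.

Lemma coind_scaleDl c : {morph coind_scale^~ c : a b / a + b}.
Proof. by move=> a b; apply: coind_eq => x /=; rewrite mulrDr coindD. Qed.

HB.instance Definition _ := GRing.Zmodule_isLmodule.Build k coind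
  coind_scaleA coind_scale1 coind_scaleDr coind_scaleDl.

End Coinduced.

Section ProductSheaf.
Variables (k : comNzRingType) (T : topologicalType) (P : set T).
Variables (I : Type) (pos : I -> T) (M : lmodType k).

Definition psec_pred (O : opens P) : {pred I -> M} :=
  fun s => `[< forall i, ~ oset O (pos i) -> s i = 0 >].

Lemma psec_submod_closed (O : opens P) : submod_closed (psec_pred O).
Proof.
split=> [|c s t /asboolP s0 /asboolP t0]; apply/asboolP => // i iO.
by rewrite -[LHS]/(c *: s i + t i) s0 // t0 // scaler0 addr0.
Qed.

HB.instance Definition _ (O : opens P) :=
  GRing.isSubmodClosed.Build k (I -> M) (psec_pred O) (psec_submod_closed O).

Record psec (O : opens P) := Psec {
  psec_fun :> I -> M; psecP : psec_fun \in psec_pred O }.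

HB.instance Definition _ (O : opens P) := [isSub for @psec_fun O].
HB.instance Definition _ (O : opens P) := [Choice of psec O by <:].
HB.instance Definition _ (O : opens P) := [SubChoice_isSubLmodule of psec O by <:].

Lemma psec_out (O : opens P) (s : psec O) i : ~ oset O (pos i) -> s i = 0.
Proof. by have /asboolP := psecP s; apply. Qed.

Lemma psec_eq (O : opens P) (s t : psec O) :
  (forall i, oset O (pos i) -> s i = t i) -> s = t.
Proof.
move=> st; apply/val_inj/funext => i /=.
by have [/st//|iO] := pselect (oset O (pos i)); rewrite !psec_out.
Qed.

Definition pcut (O : opens P) (s : I -> M) : I -> M :=
  fun i => if `[< oset O (pos i) >] then s i else 0.

Lemma pcut_subproof (O : opens P) (s : I -> M) : pcut O s \in psec_pred O.
Proof. by apply/asboolP => i iO; rewrite /pcut asboolF. Qed.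

Definition pres (O O' : opens P) (s : psec O) : psec O' := Psec (pcut_subproof O' s).

Lemma presE (O O' : opens P) (s : psec O) i : oset O' (pos i) -> pres O' s i = s i.
Proof. by move=> iO; rewrite /= /pcut asboolT. Qed.

Lemma pres_linear (O O' : opens P) : linear (@pres O O').
Proof.
move=> c s t; apply: psec_eq => i iO; rewrite presE //.
by rewrite -[RHS]/(c *: pres O' s i + pres O' t i) !presE.
Qed.

HB.instance Definition _ (O O' : opens P) :=
  GRing.isLinear.Build k (psec O) (psec O') *:%R (@pres O O') (@pres_linear O O').

Lemma pres_glue (J : Type) (D : J -> opens P) (O : opens P)
    (hD : forall j, D j `<=` O) : (forall x, oset O x -> exists j, oset (D j) x) ->
  forall s : forall j, psec (D j),
  (forall i j (O' : opens P) (hi : O' `<=` D i) (hj : O' `<=` D j),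
     pres O' (s i) = pres O' (s j)) ->
  exists! t : psec O, forall j, pres (D j) t = s j.
Proof.
move=> cov s compat.
have agree j j' i : oset (D j) (pos i) -> oset (D j') (pos i) -> s j i = s j' i.
  move=> ji j'i.
  have := compat j j' _ (@meetl _ _ (D j) (D j')) (@meetr _ _ (D j) (D j')).
  by move=> /(congr1 (fun u : psec _ => u i)); rewrite !presE.
pose g i := if pselect (exists j, oset (D j) (pos i)) is left e
  then s (projT1 (cid e)) i else 0.
have gE j i : oset (D j) (pos i) -> g i = s j i.
  rewrite /g; case: pselect => [e ji|ne ji]; last by case: ne; exists j.
  by case: (cid e) => j' j'i /=; apply: agree.
have gP : g \in psec_pred O.
  apply/asboolP => i iO; rewrite /g; case: pselect => // -[j ji].
  by case: iO; apply: hD ji.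
exists (Psec gP); split=> [j|t tE].
  by apply: psec_eq => i ji; rewrite presE //=; apply: gE.
apply: psec_eq => i /cov[j ji].
by rewrite /= (gE j) // -(tE j) presE.
Qed.

Lemma pres_id (O : opens P) (h : O `<=` O) (s : psec O) : pres O s = s.
Proof. by apply: psec_eq => i iO; rewrite presE. Qed.

Lemma pres_comp (O O' O'' : opens P) (h : O' `<=` O) (h' : O'' `<=` O')
  (h'' : O'' `<=` O) (s : psec O) : pres O'' (pres O' s) = pres O'' s.
Proof. by apply: psec_eq => i iO; rewrite !presE //; apply: h'. Qed.

(** The product of the skyscraper sheaves with stalk [M] at the points [pos i]. *)
Definition psheaf : sheaf k P :=
  @Sheaf k T P (fun O => psec O : lmodType k) (fun O O' h => @pres O O')
    pres_id pres_comp pres_glue.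

End ProductSheaf.
(** * Injective resolutions *)

Section Separated.
Variables (k : comNzRingType) (T : topologicalType) (P : set T).

Lemma sheaf_separated (F : sheaf k P) (O : opens P) (s : sec F O) :
  (forall x, oset O x -> exists (O' : opens P) (h : O' `<=` O),
     oset O' x /\ res F h s = 0) -> s = 0.
Proof.
move=> sl.
have D_ x : exists OO : opens P, OO `<=` O /\
    (oset O x -> oset OO x /\ forall h : OO `<=` O, res F h s = 0).
  have [xO|xO] := pselect (oset O x); last by exists O; split.
  have [OO [h [xOO s0]]] := sl x xO; exists OO; split=> // _; split=> // h'.
  by rewrite (Prop_irrelevance h' h).
pose D (i : {x | oset O x}) := sval (cid (D_ (sval i))).
have hD i : D i `<=` O by rewrite /D; case: cid => ? [].
have DP (i : {x | oset O x}) : oset (D i) (sval i) /\ res F (hD i) s = 0.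
  have : D i `<=` O /\ (oset O (sval i) -> oset (D i) (sval i) /\
    forall h : D i `<=` O, res F h s = 0) := svalP (cid (D_ (sval i))).
  by case=> _ /(_ (svalP i))[iD s0]; split.
have cov x : oset O x -> exists i, oset (D i) x.
  by move=> xO; exists (exist _ x xO); have [] := DP (exist _ x xO).
have [|t [_ tU]] := @res_glue _ _ _ F _ D O hD cov (fun i => 0).
  by move=> i j O' hi hj; rewrite !raddf0.
transitivity t; last by apply: tU => i; rewrite raddf0.
by apply/esym/tU => i; have [] := DP i.
Qed.

End Separated.

Section InjectiveResolution.
Variables (k : comNzRingType) (T : topologicalType) (P : set T).

Section Injective.
Variables (I : Type) (pos : I -> stalk_point P).
Local Notation J := (@psheaf k T P I (fun i => pt (pos i)) (coind k)).

Let ev (O : opens P) (s : sec J O) (i : I) (a : k) : QmodZ :=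
  coind_fun (psec_fun (s : psec (fun i => pt (pos i)) (coind k) O) i) a.

(** Evaluation at 1 turns the component of [g] at [i] into a character of the stalk
    of [F], which extends along the monomorphism by injectivity of Q/Z. *)
Lemma psheaf_extension (F G : sheaf k P) (m : sheaf_hom F G) (g : sheaf_hom F J) i :
  sheaf_mono m -> exists mu : {additive stalk G (pos i) -> QmodZ},
    forall O (s : sec F O), oset O (pt (pos i)) -> mu (germ _ (m O s)) = ev (g O s) i 1.
Proof.
move=> inj_m.
have gres (O O' : opens P) (h : O' `<=` O) (s : sec F O) :
    oset O' (pt (pos i)) -> ev (g O' (res F h s)) i 1 = ev (g O s) i 1.
  by move=> iO'; rewrite /ev app_res /= /pcut asboolT.
pose Gr := [set u : stalk G (pos i) * QmodZ | exists (O : opens P) (s : sec F O),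
  [/\ oset O (pt (pos i)), u.1 = germ _ (m O s) & u.2 = ev (g O s) i 1]].
have gGr : additive_graph Gr.
  split=> [|[_ _] [_ _] [ O [s /= [iO -> ->]]] [ O' [t /= [iO' -> ->]]]|d].
  - exists (pt_open (pos i)), 0; split; rewrite ?raddf0 //=; exact: pt_mem.
  - have i' : oset (meet O O') (pt (pos i)) by [].
    exists (meet O O'), (res F (@meetl _ _ O O') s - res F (@meetr _ _ O O') t).
    split=> //=; first by rewrite !raddfB /= !app_res !germ_res.
    by rewrite -(gres _ _ (@meetl _ _ O O') s) // -(gres _ _ (@meetr _ _ O O') t) // raddfB.
  - move=> [ O [s /= [iO]]]; rewrite -(raddf0 (@germ _ _ _ G (pos i) O)).
    move=> /esym/(germ_eq iO iO)[ O' [h [h' [iO' e]]]] ->.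
    rewrite -(gres _ _ h s iO').
    suff -> : res F h s = 0 by rewrite raddf0.
    by apply: inj_m; rewrite app_res e !raddf0.
have [mu muP] := divisible_extension divisible_QmodZ gGr.
by exists mu => O s iO; apply: muP; exists O, s.
Qed.

(** The extended characters are converted back into sections by letting [k] act on
    the argument. *)
Lemma psheaf_injective : injective_sheaf J.
Proof.
move=> F G m g inj_m.
pose mu i := sval (cid (psheaf_extension g i inj_m)).
have muP i O (s : sec F O) : oset O (pt (pos i)) ->
  mu i (germ _ (m O s)) = ev (g O s) i 1 := svalP (cid (psheaf_extension g i inj_m)) O s.
have coP (O : opens P) (t : sec G O) i :
    (fun a : k => mu i (germ _ (a *: t))) \in @coind_pred k.
  by apply/asboolP => a b; rewrite scalerBl !raddfB.
have psP (O : opens P) (t : sec G O) :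
    (fun i => Coind (coP O t i)) \in @psec_pred k T P I (fun i => pt (pos i)) (coind k) O.
  by apply/asboolP => i iO; apply: coind_eq => a /=; rewrite germ_out // raddf0.
pose ext O t : sec J O := Psec (psP O t).
have ext_linear O : linear (ext O).
  move=> c s t; apply: psec_eq => i iO; apply: coind_eq => a.
  rewrite -[RHS]/(mu i (germ _ ((a * c) *: s)) + mu i (germ _ (a *: t))) /=.
  by rewrite scalerDr scalerA !raddfD.
pose extL O : {linear sec G O -> sec J O} :=
  HB.pack (ext O) (GRing.isLinear.Build k (sec G O) (sec J O) *:%R (ext O) (ext_linear O)).
have ext_res (O O' : opens P) (h : O' `<=` O) (s : sec G O) :
    extL O' (res G h s) = res J h (extL O s).
  apply: psec_eq => i iO'; apply: coind_eq => a.
  by rewrite /= /pcut asboolT //= -linearZ germ_res.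
exists (SheafHom ext_res) => O s.
apply: psec_eq => i iO; apply: coind_eq => a /=.
by rewrite -linearZ muP // linearZ /ev /= mul1r.
Qed.

End Injective.

(** One step of the resolution. The target is indexed by the characters of the stalks
    of [B] that vanish on the image of [A]; since they separate germs from that image,
    the kernel of the map consists of the sections that lift locally to [A], and no
    quotient sheaf has to be formed. *)
Section Step.
Variables (A B : sheaf k P) (g : sheaf_hom A B).

Record chars := Chars {
  char_pt : stalk_point P;
  char_fun : {additive stalk B char_pt -> QmodZ};
  char_vanish : forall O (t : sec A O), char_fun (germ _ (g O t)) = 0 }.

Definition step_sheaf : sheaf k P :=
  psheaf P (fun i : chars => pt (char_pt i)) (coind k).

Lemma step_coind_subproof (O : opens P) (s : sec B O) (i : chars) :
  (fun a : k => char_fun i (germ _ (a *: s))) \in @coind_pred k.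
Proof. by apply/asboolP => a b; rewrite scalerBl !raddfB. Qed.

Lemma step_psec_subproof (O : opens P) (s : sec B O) :
  (fun i => Coind (step_coind_subproof s i)) \in
    @psec_pred k T P chars (fun i => pt (char_pt i)) (coind k) O.
Proof. by apply/asboolP => i iO; apply: coind_eq => a /=; rewrite germ_out // raddf0. Qed.

Definition step_fun (O : opens P) (s : sec B O) : sec step_sheaf O :=
  Psec (step_psec_subproof s).

Lemma step_linear (O : opens P) : linear (@step_fun O).
Proof.
move=> c s t; apply: psec_eq => i iO; apply: coind_eq => a.
rewrite -[RHS]/(char_fun i (germ _ ((a * c) *: s)) + char_fun i (germ _ (a *: t))) /=.
by rewrite scalerDr scalerA !raddfD.
Qed.

HB.instance Definition _ (O : opens P) :=
  GRing.isLinear.Build k (sec B O) (sec step_sheaf O) *:%R (@step_fun O) (@step_linear O).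

Lemma step_res (O O' : opens P) (h : O' `<=` O) (s : sec B O) :
  step_fun (res B h s) = res step_sheaf h (step_fun s).
Proof.
apply: psec_eq => i iO'; apply: coind_eq => a.
by rewrite /= /pcut asboolT //= -linearZ germ_res.
Qed.

Definition step_hom : sheaf_hom B step_sheaf :=
  @SheafHom k T P B step_sheaf (fun O => @step_fun O) step_res.

(** If a section has no lift near [x], some character of the stalk at [x] kills the
    image of [A] but not the germ of the section. *)
Lemma step_exact : sheaf_exact g step_hom.
Proof.
move=> O s; split=> [s0 x xO|lift]; last first.
  apply: psec_eq => i iO; apply: coind_eq => a /=.
  have [ O' [h [iO' [t gt]]]] := lift _ iO.
  by rewrite -(germ_res h) // linearZ /= -gt -linearZ char_vanish.
apply: contrapT => nolift.
pose p := StalkPoint xO.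
pose S := [set u : stalk B p | exists (O' : opens P) (t : sec A O'),
  oset O' x /\ u = germ _ (g O' t)].
have gS : subgroup S.
  split; first by exists O, 0; rewrite !raddf0.
  move=> _ _ [ O1 [t1 [x1 ->]]] [ O2 [t2 [x2 ->]]].
  exists (meet O1 O2), (res A (@meetl _ _ O1 O2) t1 - res A (@meetr _ _ O1 O2) t2).
  by split=> //; rewrite !raddfB /= !app_res !germ_res.
have Ss : ~ S (germ p s).
  move=> [ O1 [t1 [x1 e]]]; apply: nolift.
  have [ O2 [h [h' [x2 e2]]]] := @germ_eq _ _ _ B p _ _ _ _ xO x1 e.
  by exists O2, h; split=> //; exists (res A h' t1); rewrite app_res -e2.
have [mu [muS mus]] := QmodZ_separates gS Ss; case: mus.
have vanish O' (t : sec A O') : mu (germ _ (g O' t)) = 0.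
  have [xO'|xO'] := pselect (oset O' x); last by rewrite germ_out ?raddf0.
  by apply: muS; exists O', t.
have := congr1 (fun u : psec _ _ _ => coind_fun (psec_fun u (Chars vanish)) 1) s0.
by rewrite /= scale1r.
Qed.

End Step.

(** Used as the first map: then exactness at [F] says that the augmentation is a
    monomorphism. *)
Definition zero_hom (F : sheaf k P) : sheaf_hom F F :=
  @SheafHom k T P F F (fun O => \0%VF) (fun O O' h s => esym (raddf0 (res F h))).

Lemma step_zero_mono (F : sheaf k P) : sheaf_mono (step_hom (zero_hom F)).
Proof.
move=> O s t e; apply/subr0_eq/sheaf_separated => x xO.
have /(step_exact (zero_hom F)) e0 : step_hom (zero_hom F) O (s - t) = 0.
  by rewrite raddfB /= e subrr.
by have [ O' [h [xO' [u e']]]] := e0 x xO; exists O', h; rewrite -e'.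
Qed.

Record stage := Stage { st_dom : sheaf k P; st_cod : sheaf k P;
  st_hom : sheaf_hom st_dom st_cod }.

(** The step applied to the [n]-th map has the codomain of that map as its source, so
    consecutive stages compose and [step_exact] is exactness of the resolution. *)
Fixpoint stages (F : sheaf k P) (n : nat) : stage :=
  if n is m.+1 then Stage (step_hom (st_hom (stages F m)))
  else Stage (step_hom (zero_hom F)).

Lemma stages_injective (F : sheaf k P) n : injective_sheaf (st_cod (stages F n)).
Proof. by case: n => [|n]; apply: psheaf_injective. Qed.

Definition char_resolution (F : sheaf k P) : injective_resolution F :=
  @InjectiveResolution k T P F (fun n => st_cod (stages F n))
    (fun n => step_hom (st_hom (stages F n))) (step_hom (zero_hom F))
    (@stages_injective F) (@step_zero_mono F)
    (step_exact _) (fun n => step_exact (st_hom (stages F n.+1))).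

End InjectiveResolution.
(** * Propagation in degrees 0 and 1 *)

Section LocalCohomology.
Variables (k : comNzRingType) (T : topologicalType) (P : set T) (F : sheaf k P).
Variables (N : opens P) (Z : set T) (p : T).
Variables (O D : opens P) (DO : D `<=` O).
Hypotheses (ON : O `<=` N) (pO : oset O p).
Hypothesis DE : forall x, oset O x -> ~ Z x -> oset D x.
Hypothesis DZ : forall x, oset D x -> ~ Z x.
Hypothesis acyclic : RGamma_stalk_zero N Z F p.

Variable I : injective_resolution F.

Lemma supported_inP n (s : sec (ires_obj I n) O) :
  res (ires_obj I n) DO s = 0 -> supported_in Z s.
Proof.
move=> s0 O' h O'Z; have h' : O' `<=` D.
  move=> x xO'; apply: DE; first exact: h.
  by move=> xZ; have : set0 x by rewrite -O'Z.
by rewrite -(res_comp DO h') s0 raddf0.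
Qed.

(** The section is a 0-cocycle supported in [Z]. *)
Lemma acyclic_restriction_injective (s : sec F O) : res F DO s = 0 ->
  exists (O' : opens P) (h : O' `<=` O), oset O' p /\ res F h s = 0.
Proof.
move=> s0; have [|| O' [h [pO' e]]] := acyclic (r := I) (n := 0%N) (s := ires_aug I O s) ON pO.
- by apply: supported_inP; rewrite -app_res s0 raddf0.
- apply: (@ires_exact0 _ _ _ _ I _ _).2 => x xO; exists O, (@subset_refl _ _); split=> //.
  by exists s; rewrite res_id.
exists O', h; split=> //; apply: (@ires_mono _ _ _ _ I O').
by rewrite app_res e raddf0.
Qed.

(** A flabby first term lets the section extend there; the defect of the
    extension is a 1-cocycle supported in [Z]. *)
Lemma acyclic_extension (s : sec F D) :
  (forall s : sec (ires_obj I 0) D, exists t, res (ires_obj I 0) DO t = s) ->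
  exists (O' : opens P) (h : O' `<=` O) (w : sec F O'),
    oset O' p /\ res F (@meetl _ _ O' D) w = res F (@meetr _ _ O' D) s.
Proof.
move=> /(_ (ires_aug I D s))[t tE].
have exact_aug (O' : opens P) (u : sec F O') : ires_d I 0 O' (ires_aug I O' u) = 0.
  apply: (@ires_exact0 _ _ _ _ I _ _).2 => x xO; exists O', (@subset_refl _ _); split=> //.
  by exists u; rewrite res_id.
have [|| O1 [h1 [pO1 [v v_supp dv]]]] :=
    acyclic (r := I) (n := 1%N) (s := ires_d I 0 O t) ON pO.
- by apply: supported_inP; rewrite -app_res tE exact_aug.
- apply: (@ires_exactS _ _ _ _ I 0%N _ _).2 => x xO; exists O, (@subset_refl _ _); split=> //.
  by exists t; rewrite res_id.
have : ires_d I 0 O1 (res _ h1 t - v) = 0 by rewrite raddfB /= dv app_res subrr.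
move=> /(@ires_exact0 _ _ _ _ I _ _).1 /(_ _ pO1)[ O2 [h2 [pO2 [w wE]]]].
exists O2, (subset_trans h2 h1), w; split=> //.
apply: (@ires_mono _ _ _ _ I _); rewrite !app_res wE -tE.
have hD : meet O2 D `<=` O by move=> x [_ /DO].
rewrite (res_comp h2 _ (subset_trans (@meetl _ _ O2 D) h2)) (res_comp DO _ hD).
rewrite raddfB /= (res_comp h1 _ hD) v_supp ?subr0 //.
by apply/seteqP; split=> // x [[_ /DZ]].
Qed.

End LocalCohomology.

(** Sections of a product of skyscraper sheaves extend by zero. *)
Lemma char_resolution_flabby (k : comNzRingType) (T : topologicalType) (P : set T)
  (F : sheaf k P) (O D : opens P) (DO : D `<=` O)
  (s : sec (ires_obj (char_resolution F) 0) D) :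
  exists t, res (ires_obj (char_resolution F) 0) DO t = s.
Proof.
by exists (pres O s); apply: psec_eq => i iD; rewrite !presE //; apply: DO.
Qed.

Section ConstantSheafPropagation.
Variables (k : comNzRingType) (R : realType) (E : normedModType R) (P A C : set E).
Local Notation F := (const_sheaf k P A).
Hypotheses (closedC : closed C) (AC : forall x, P x -> A x <-> C x).

Definition indicator (S : set E) : E -> k^o := fun x => if `[< S x >] then 1 else 0.

(** The support condition at points outside [A] holds because [A] is relatively
    closed in [P]. *)
Lemma indicator_sec (D : opens P) (S S' : set E) : open S -> open S' ->
  (forall x, oset D x -> A x -> S x \/ S' x) ->
  (forall x, oset D x -> A x -> S x -> ~ S' x) ->
  const_sec_prop A D (indicator (D `&` A `&` S)).
Proof.
move=> oS oS' cov disj.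
have loc x : (D `&` A) x -> \forall y \near x, (D `&` A) y ->
    indicator (D `&` A `&` S) y = indicator (D `&` A `&` S) x.
  move=> [Dx Ax]; have [Sx|S'x] := cov x Dx Ax.
  - apply: (@filterS _ (nbhs x) _ S) => [y Sy DAy|]; last exact: open_nbhs_nbhs.
    by rewrite /indicator !asboolT.
  - apply: (@filterS _ (nbhs x) _ S') => [y Sy [Dy Ay]|]; last exact: open_nbhs_nbhs.
    by rewrite /indicator !asboolF // => -[_ ?]; [apply: (disj x)|apply: (disj y)].
split=> // [x nDA|x Dx]; first by rewrite /indicator asboolF // => -[].
have [Ax s0|nAx _] := pselect (A x).
  apply: (@filterS _ (nbhs x) _ _ _ _ (loc x (conj Dx Ax))) => y.
  rewrite s0; have [DAy ->//|nDAy _] := pselect ((D `&` A) y).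
  by rewrite /indicator asboolF // => -[].
have : nbhs x (D `&` ~` C).
  apply: open_nbhs_nbhs; split; first by apply: openI (open_oset D) (closed_openC closedC).
  by split=> // /(AC (sub_oset Dx)).
apply: (@filterS _ (nbhs x)) => y [Dy nCy].
by rewrite /indicator asboolF // => -[[_ Ay] _]; apply/nCy/(AC (sub_oset Dy)).
Qed.

Variables (p : E) (xi : dual E) (N : opens P) (phi : E -> R^o).
Hypotheses (pA : A p) (pN : oset N p) (smooth_phi : smooth_on N phi).
Hypotheses (phi_p : phi p = 0) (dphi_p : 'd phi p =1 xi).
Hypothesis prop_p : propagates F p xi.

Lemma open_neg : open (N `&` [set x | phi x < 0]).
Proof.
rewrite openE => x [Nx nx].
have cx : {for x, continuous phi}.
  exact: differentiable_continuous (smooth_phi [::] Nx).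
apply: filterI; first exact: open_nbhs_nbhs (conj (open_oset N) Nx).
by move: nx; apply: (@cvgr_lt _ _ _ _ phi (phi x) cx).
Qed.

Definition neg_part : opens P := @Opens _ P _ open_neg (fun x h => sub_oset h.1).

(** Otherwise the section 1 near [p] would be supported in [phi >= 0] without
    vanishing at [p]. *)
Lemma propagates_near (B : set E) : nbhs p B -> exists x, [/\ B x, A x & phi x < 0].
Proof.
move=> pB; have Bp : interior B p by [].
apply: contrapT => noneg.
have oO : open (interior B `&` N) by apply: openI; [exact: open_interior|exact: open_oset].
pose O : opens P := @Opens _ P _ oO (fun x h => sub_oset h.2).
have NO : O `<=` N by move=> x [].
have sP : indicator (O `&` A `&` setT) \in @const_sec_pred k E P A O.
  apply/asboolP; apply: (@indicator_sec O setT set0); 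
    [exact: openT | exact: open0 | by left | by move=> x _ _ _ []].
have s0 : res F (@meetl _ _ O neg_part) (ConstSec sP) = 0.
  apply: const_sec_eq => x [[Bx Nx] [_ nx]]; rewrite const_resE //=.
  rewrite /indicator asboolF // => -[[_ Ax] _]; apply: noneg.
  by exists x; split=> //; apply: interior_subset.
have [| O' [h [pO' e]]] := acyclic_restriction_injective NO (conj Bp pN) _
    (prop_p pN smooth_phi phi_p dphi_p) (char_resolution F) s0.
  move=> x Ox xZ; have Nx := NO _ Ox; refine (conj Ox (conj Nx _)).
  by rewrite /= ltNge; apply/negP => ge0; apply: xZ.
have := congr1 (fun u : const_sec k A O' => const_fun u p) e.
rewrite /= /const_res_fun asboolT // /indicator asboolT //.
by move/eqP; rewrite oner_eq0.
Qed.

(** The obstruction to extending the section 1 on [S], 0 on [S'] lies in the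
    first cohomology supported in [phi >= 0]. *)
Lemma propagates_extension (B S S' : set E) : nbhs p B -> open S -> open S' ->
    (forall x, B x -> A x -> phi x < 0 -> S x \/ S' x) ->
    (forall x, B x -> A x -> phi x < 0 -> S x -> ~ S' x) ->
  exists O' : set E, exists w : E -> k^o,
    [/\ open O', O' p,
      forall x, O' x -> A x -> \forall y \near x, A y -> w y = w x,
      forall x, O' x -> A x -> phi x < 0 -> S x -> w x = 1
    & forall x, O' x -> A x -> phi x < 0 -> S' x -> w x = 0].
Proof.
move=> pB oS oS' cov disj; have Bp : interior B p by [].
have oO : open (interior B `&` N) by apply: openI; [exact: open_interior|exact: open_oset].
pose O : opens P := @Opens _ P _ oO (fun x h => sub_oset h.2).
have NO : O `<=` N by move=> x [].
have OB : O `<=` B by move=> x [Bx _]; apply: interior_subset.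
pose D := meet O neg_part.
have sP : indicator (D `&` A `&` S) \in @const_sec_pred k E P A D.
  apply/asboolP; apply: (@indicator_sec D S S' oS oS') => x [Ox [_ nx]] Ax.
    by apply: cov => //; apply: OB Ox.
  by apply: disj => //; apply: OB Ox.
have [|| O' [h [w [pO' e]]]] := acyclic_extension (DO := @meetl _ _ O neg_part) NO (conj Bp pN) _ _
    (prop_p pN smooth_phi phi_p dphi_p) (ConstSec sP)
    (char_resolution_flabby (@meetl _ _ O neg_part)).
- move=> x Ox xZ; have Nx := NO _ Ox; refine (conj Ox (conj Nx _)).
  by rewrite /= ltNge; apply/negP => ge0; apply: xZ.
- by move=> x [_ [_ nx]] [_ /=]; rewrite leNgt nx.
have wE x : oset O' x -> phi x < 0 -> const_fun w x = indicator (D `&` A `&` S) x.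
  move=> xO' nx; have xOD : oset (meet O' D) x.
    by split=> //; split; [exact: h|split=> //; apply/NO/h].
  have := congr1 (fun u : const_sec k A (meet O' D) => const_fun u x) e.
  by rewrite /= /const_res_fun asboolT.
exists O', (const_fun w); split=> // [|x xO' Ax|x xO' Ax nx Sx|x xO' Ax nx S'x].
- exact: open_oset.
- have [_ /(_ x (conj xO' Ax)) wloc _] := const_secP w.
  apply: (@filterS2 _ (nbhs x) _ _ _ _ _ wloc (open_nbhs_nbhs (conj (open_oset O') xO'))).
  by move=> y wy yO' Ay; apply: wy.
- rewrite wE // /indicator asboolT //; split=> //; split=> //.
  by split; [exact: h|split=> //; apply/NO/h].
- rewrite wE // /indicator asboolF // => -[_ Sx].
  by apply: (disj x) => //; apply/OB/h.
Qed.

End ConstantSheafPropagation.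
(** * Smooth test functions *)

Section Flat.
Variable R : realType.
Implicit Types (P : {poly R}) (t : R).

(** For [P = 1] this is exp(-1/t) extended by zero; the polynomial factors make
    the family stable under differentiation. *)
Definition flat P t : R := if 0 < t then P.[t^-1] * expR (- t^-1) else 0.

Definition flat_deriv P : {poly R} := 'X^2 * (P - P^`()).

Lemma flat_pos P t : 0 < t -> flat P t = P.[t^-1] * expR (- t^-1).
Proof. by rewrite /flat => ->. Qed.

Lemma flat_npos P t : t <= 0 -> flat P t = 0.
Proof. by rewrite /flat leNgt => /negbTE ->. Qed.

Lemma flat1_gt0 t : 0 < t -> 0 < flat 1 t.
Proof. by move=> t0; rewrite flat_pos // hornerC mul1r expR_gt0. Qed.

(** Each monomial is bounded by a multiple of the exponential, by its power series. *)
Lemma horner_expRN_bounded P :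
  exists C, forall u : R, 0 <= u -> `|P.[u] * expR (- u)| <= C.
Proof.
exists (\sum_(i < size P) `|P`_i| * i.+1`!%:R) => u u0.
rewrite horner_coef mulr_suml (le_trans (ler_norm_sum _ _ _)) // ler_sum // => i _.
rewrite -mulrA normrM ler_wpM2l // normrM !ger0_norm ?expR_ge0 ?exprn_ge0 //.
rewrite expRN ler_pdivrMr ?expR_gt0 //.
have fact0 n : 0 < n`!%:R :> R by rewrite ltr0n fact_gt0.
case: i => -[|i] _ /=.
  by rewrite expr0 mul1r (le_trans _ (expR_ge1Dx u)) // lerDl.
have := expR_ge1Dxn i u0 => /(le_trans _) -/(_ (u ^+ i.+1 / i.+1`!%:R)).
rewrite lerDr => /(_ ler01); rewrite ler_pdivrMr // => /le_trans; apply.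
by rewrite mulrC ler_wpM2r ?expR_ge0 // ler_nat leq_fact.
Qed.

Lemma flat_quadratic P : exists C, forall t, `|flat P t| <= C * t ^+ 2.
Proof.
have [C CP] := horner_expRN_bounded ('X^2 * P).
have C0 : 0 <= C by apply: le_trans (CP 0 (lexx _)).
exists C => t; have [t0|t0] := ltP 0 t; last by rewrite flat_npos // normr0 mulr_ge0 ?sqr_ge0.
have ti : 0 <= t^-1 by rewrite invr_ge0 ltW.
have := CP t^-1 ti.
rewrite flat_pos // hornerM hornerXn -mulrA normrM ger0_norm ?exprn_ge0 //.
by rewrite -ler_pdivlMl ?exprn_gt0 ?invr_gt0 // exprVn invrK => /le_trans; apply; rewrite mulrC.
Qed.

(** The slope of [flat P] at 0 is again a flat function. *)
Lemma flat_mulX P t : flat P t = flat ('X * P) t * t.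
Proof.
have [t0|t0] := ltP 0 t; last by rewrite !flat_npos ?mul0r.
rewrite !flat_pos // hornerM hornerX -mulrA [_ * t]mulrC !mulrA.
by rewrite [_^-1 * _ * t]mulrAC mulVf ?gt_eqF // mul1r.
Qed.

Lemma flat_continuous0 P : flat P t @[t --> (0 : R)] --> (0 : R).
Proof.
have [C CP] := flat_quadratic P.
have C0 : C * t ^+ 2 @[t --> (0 : R)] --> (0 : R).
  suff : C * t ^+ 2 @[t --> (0 : R)] --> C * 0 ^+ 2 by rewrite expr0n mulr0.
  by apply: cvgM; [exact: cvg_cst | exact: exprn_continuous].
apply: (@squeeze_cvgr _ _ _ _ (fun t => - (C * t ^+ 2)) (fun t => C * t ^+ 2)) => //.
  by near=> t; rewrite -ler_norml.
by rewrite -[X in _ --> X]oppr0; apply: cvgN.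
Unshelve. all: by end_near. Qed.

(** At 0, Caratheodory's criterion applies with slope [flat ('X * P)]. *)
Lemma flat_is_derive P t : is_derive t 1 (flat P) (flat (flat_deriv P) t).
Proof.
have [t0|t0|->] := ltgtP t 0.
- rewrite flat_npos ?ltW //.
  apply: (@near_eq_is_derive _ _ _ (cst 0)).
  by apply: filterS (lt_nbhsl t0) => y y0; rewrite flat_npos // ltW.
- rewrite flat_pos //.
  apply: (@near_eq_is_derive _ _ _ (fun t => P.[t^-1] * expR (- t^-1))).
    by apply: filterS (lt_nbhsr t0) => y y0; rewrite flat_pos.
  have tN0 : t != 0 by rewrite gt_eqF.
  have dinv : is_derive t 1 (fun t : R => t^-1) (- t^-1 ^+ 2).
    have := @is_deriveV R id t 1 1 tN0; rewrite /GRing.scale /= mulr1.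
    by rewrite -exprVn; apply.
  have dP : is_derive t 1 (fun t => P.[t^-1]) (P^`().[t^-1] * (- t^-1 ^+ 2)).
    apply: (@is_derive1_comp _ (horner P) (fun t : R => t^-1)) => //.
  have dN : is_derive t 1 (fun t : R => - t^-1) (t^-1 ^+ 2).
    by rewrite -[X in is_derive _ _ _ X]opprK; apply: is_deriveN.
  have dE : is_derive t 1 (fun t => expR (- t^-1)) (expR (- t^-1) * t^-1 ^+ 2).
    exact: (@is_derive1_comp _ expR (fun t : R => - t^-1)).
  have := is_deriveM dP dE; move=> /is_derive_eq; apply.
  rewrite /flat_deriv hornerM hornerXn hornerD hornerN /GRing.scale /=.
  by ring.
- rewrite flat_npos //; apply/is_derive1_caratheodory.
  exists (flat ('X * P)); split=> [z||].
  + by rewrite [flat P 0]flat_npos // !subr0 flat_mulX.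
  + rewrite /prop_for /continuous_at flat_npos //; exact: flat_continuous0.
  + by rewrite flat_npos.
Qed.

End Flat.
Section SmoothExpressions.
Variable R : realType.

(** A class of functions closed under directional derivatives, large enough to
    contain the test functions used below. *)
Inductive smooth_expr (E : normedModType R) : (E -> R^o) -> Prop :=
  | smooth_cst (c : R^o) : smooth_expr (fun=> c)
  | smooth_lin (l : {linear E -> R^o}) : continuous l -> smooth_expr l
  | smooth_add f g : smooth_expr f -> smooth_expr g -> smooth_expr (fun x => f x + g x)
  | smooth_mul f g : smooth_expr f -> smooth_expr g -> smooth_expr (fun x => f x * g x)
  | smooth_flat P u : smooth_expr u -> smooth_expr (fun x => flat P (u x)).

(** The class is closed under directional derivatives because the derivative of
    [flat P] is [flat] of another polynomial. *)
Lemma smooth_expr_diff (E : normedModType R) (f : E -> R^o) : smooth_expr f ->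
  exists df : E -> E -> R^o,
    (forall x, is_diff x f (df x)) /\ (forall v, smooth_expr (fun x => df x v)).
Proof.
elim=> {f} [c|l cl|f g sf [df [dfP dfS]] sg [dg [dgP dgS]]|f g sf [df [dfP dfS]] sg [dg [dgP dgS]]
  |P u su [du [duP duS]]].
- by exists (fun=> 0); split=> [x|v]; [exact: is_diff_cst|exact: smooth_cst].
- exists (fun=> l); split=> [x|v]; last exact: smooth_cst.
  by apply: DiffDef; [exact: linear_differentiable|exact: diff_lin].
- by exists (fun x v => df x v + dg x v); split=> [x|v]; [exact: is_diffD|exact: smooth_add].
- exists (fun x v => f x * dg x v + g x * df x v); split=> [x|v].
    exact: is_diffM.
  by apply: smooth_add; apply: smooth_mul.
- exists (fun x v => flat (flat_deriv P) (u x) * du x v); split=> [x|v]; last first.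
    by apply: smooth_mul => //; apply: smooth_flat.
  have [dP fE] := flat_is_derive P (u x).
  have dP' : is_diff (u x) (flat P : R^o -> R^o) (fun h => h *: flat (flat_deriv P) (u x)).
    apply: DiffDef; first exact/derivable1_diffP.
    by rewrite deriv1E // derive1E fE.
  have := @is_diff_comp _ _ _ _ u (du x) (flat P : R^o -> R^o) _ x (duP x) dP'.
  by move=> /is_diff_eq; apply; apply/funext => v; rewrite /= mulrC.
Qed.

Lemma smooth_expr_differentiable (E : normedModType R) (f : E -> R^o) x :
  smooth_expr f -> differentiable f x.
Proof. by case/smooth_expr_diff => df [/(_ x)[]]. Qed.

Lemma smooth_expr_smooth_on (E : normedModType R) (f : E -> R^o) (N : set E) :
  smooth_expr f -> smooth_on N f.
Proof.
move=> sf vs x _; apply: smooth_expr_differentiable; elim: vs => //= v vs.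
set g := foldr _ _ _ => /smooth_expr_diff[dg [dgP dgS]].
have -> : 'D_v g = (fun y => dg y v); last exact: dgS.
by apply/funext => y; have [dgy dgE] := dgP y; rewrite deriveE // dgE.
Qed.

Lemma smooth_expr_comp (E E' : normedModType R) (l : {linear E' -> E}) (c : E)
    (f : E -> R^o) : continuous l -> smooth_expr f -> smooth_expr (fun x => f (l x + c)).
Proof.
move=> cl; elim=> {f} [e|m cm|f g _ sf _ sg|f g _ sf _ sg|P u _ su].
- exact: smooth_cst.
- have -> : (fun x => m (l x + c)) = (fun x => (m \o l) x + m c).
    by apply/funext => x; rewrite linearD.
  apply: smooth_add; last exact: smooth_cst.
  by apply: smooth_lin => x; apply: continuous_comp; [exact: cl|exact: cm].
- exact: smooth_add.
- exact: smooth_mul.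
- exact: smooth_flat.
Qed.

Lemma smooth_sum (E : normedModType R) n (f : 'I_n -> E -> R^o) :
  (forall i, smooth_expr (f i)) -> smooth_expr (fun x => \sum_i f i x).
Proof.
elim: n f => [|n IH] f sf.
  have -> : (fun x => \sum_i f i x) = (fun=> 0) by apply/funext => x; rewrite big_ord0.
  exact: smooth_cst.
have -> : (fun x => \sum_i f i x) = (fun x => f ord0 x + \sum_(i < n) f (lift ord0 i) x).
  by apply/funext => x; rewrite big_ord_recl.
by apply: smooth_add => //; apply: IH.
Qed.

End SmoothExpressions.
(** * Propagation on a graph *)

Lemma connected_split (T : topologicalType) (A S S' : set T) :
    connected A -> open S -> open S' -> A `<=` S `|` S' ->
    (forall x, A x -> S x -> ~ S' x) -> A `<=` S \/ A `<=` S'.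
Proof.
move=> cA oS oS' cov disj.
have [AS|nAS] := pselect (A `&` S !=set0); last first.
  by right=> x Ax; case: (cov x Ax) => // Sx; case: nAS; exists x.
left; suff <- : A `&` S = A by move=> x [].
apply: cA => //; first by exists S.
exists (~` S'); first exact: open_closedC.
apply/seteqP; split=> x [Ax Sx]; split=> //; first exact: disj.
by case: (cov x Ax).
Qed.

Section SegmentConnected.
Variables (R : realType) (V : normedModType R).

Lemma segment_continuous (x v : V) : continuous (fun t : R => x + t *: v).
Proof.
move=> t; apply: cvgD; first exact: cvg_cst.
by apply: cvgZr_tmp.
Qed.

Lemma line_segment_connected (x y : V) : connected (segment x y).
Proof.
apply: connected_continuous_connected.
  by apply/connected_intervalP => s t /= /andP[s0 s1] /andP[t0 t1] u /andP[su ut];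
     rewrite (le_trans s0 su) (le_trans ut t1).
by apply/continuous_subspaceT => t; apply: segment_continuous.
Qed.

Lemma segmentl (x y : V) : segment x y x.
Proof. by exists 0 => /=; rewrite ?lexx ?ler01 // scale0r addr0. Qed.

Lemma segmentr (x y : V) : segment x y y.
Proof. by exists 1 => /=; rewrite ?lexx ?ler01 // scale1r addrC subrK. Qed.

Lemma segment_ball (x y : V) (r : R) : ball x r y -> segment x y `<=` ball x r.
Proof.
rewrite -ball_normE /= => xy _ [t /= /andP[t0 t1] <-].
rewrite opprD addNKr normrN normrZ ger0_norm // distrC.
by rewrite (le_lt_trans _ xy) // -[leRHS]mul1r distrC ler_wpM2r.
Qed.

Lemma ball_connected (x : V) (r : R) : connected (ball x r).
Proof.
have [r0|r0] := ltP 0 r; last first.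
  suff -> : ball x r = set0 by exact: connected0.
  apply/seteqP; split=> // y; rewrite -ball_normE /= => xy.
  by have := le_lt_trans (normr_ge0 _) xy; rewrite ltNge r0.
have -> : ball x r = \bigcup_(y in ball x r) segment x y.
  apply/seteqP; split=> [y xy|y [z xz]]; last exact: segment_ball.
  by exists y => //; apply: segmentr.
apply: bigcup_connected => [|y _]; last exact: line_segment_connected.
by exists x => y _; apply: segmentl.
Qed.

End SegmentConnected.

Section GraphPropagation.
Variables (k : comNzRingType) (R : realType) (V W : normedModType R).
Variables (U : set V) (f : V -> W).
Hypotheses (openU : open U) (contf : {within U, continuous f}).

Let cont_fst : continuous (fst : V * W -> V). Proof. by move=> z; exact: cvg_fst. Qed.

Lemma open_continuous_at x : U x -> {for x, continuous f}.
Proof.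
move=> Ux; have := contf; rewrite continuous_open_subspace // => /(_ x).
by apply; rewrite inE.
Qed.

Lemma graph_map_continuous_at x : U x -> (fun y => (y, f y)) @ x --> (x, f x).
Proof. by move=> Ux; apply: cvg_pair => //; apply: open_continuous_at. Qed.

(** This closed set agrees with the graph over [U], where [f] is continuous. *)
Lemma graph_rel_closed : closed (~` [set z : V * W | U z.1 /\ z.2 <> f z.1]).
Proof.
apply: open_closedC; rewrite openE => -[x y] [/= Ux yfx].
have cU : \forall z \near (x, y), U z.1.
  have: fst @ (x, y) --> x by exact: cvg_fst.
  by apply; apply: open_nbhs_nbhs.
have cd : (fun z : V * W => `|z.2 - f z.1|) @ (x, y) --> `|y - f x|.
  apply: cvg_norm; apply: cvgB; first exact: cvg_snd.
  by apply: cvg_comp; [exact: cvg_fst | exact: open_continuous_at].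
have : 0 < `|y - f x| by rewrite normr_gt0 subr_eq0; apply/eqP.
move=> /(cvgr_gt _ cd) cgt.
apply: filterS2 cU cgt => -[x' y'] /= Ux' gt0; split=> // e.
by move: gt0; rewrite e subrr normr0 ltxx.
Qed.

Variables (eta0 : dual W) (cont_eta0 : continuous eta0).
Variables (Q : V -> R^o) (smQ : smooth_expr Q) (x : V) (Ux : U x).
Hypothesis prop_x : propagates (const_sheaf k (U `*` setT) (graph_on U f))
  (x, f x) (dual_pair ('d Q x) eta0).

Let psi (y : V) : R := eta0 (f y) + Q y.
Let c : R := - psi x.
Let phi (z : V * W) : R^o := eta0 z.2 + Q z.1 + c.

Lemma open_cylinder : open (U `*` [set: W]).
Proof.
rewrite openE => -[y w] [/= Uy _].
have: fst @ (y, w) --> y by exact: cvg_fst.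
move=> /(_ U (open_nbhs_nbhs (conj openU Uy))) Uz.
by apply: (@filterS _ (nbhs (y, w)) _ _ _ _ Uz) => z.
Qed.

Let N : opens (U `*` [set: W]) := Opens open_cylinder (@subset_refl _ _).

Lemma smooth_test : smooth_expr phi.
Proof.
apply: smooth_add; last exact: smooth_cst.
apply: smooth_add.
  apply: (@smooth_lin R (V * W)%type (eta0 \o snd)) => z.
  by apply: continuous_comp; [exact: cvg_snd | exact: cont_eta0].
have := @smooth_expr_comp R V (V * W)%type fst 0 Q cont_fst smQ.
by congr smooth_expr; apply/funext => z; rewrite addr0.
Qed.

Lemma diff_test : 'd phi (x, f x) =1 dual_pair ('d Q x) eta0.
Proof.
have dQ : differentiable Q x by apply: smooth_expr_differentiable.
have d1 : is_diff (x, f x) (Q \o fst : V * W -> R^o) ('d Q x \o fst).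
  apply: is_diff_comp.
    by apply: DiffDef; [apply: linear_differentiable; exact: cont_fst|apply: diff_lin; exact: cont_fst].
  exact: DiffDef.
have d2 : is_diff (x, f x) (eta0 \o snd : V * W -> R^o) (eta0 \o snd).
  have c2 : continuous (eta0 \o snd : V * W -> R^o).
    by move=> z; apply: continuous_comp; [exact: cvg_snd | exact: cont_eta0].
  by apply: DiffDef; [apply: linear_differentiable|apply: diff_lin].
have d3 := is_diffD (is_diffD d2 d1) (is_diff_cst (c : R^o) (x, f x)).
have [_ e] := d3; move=> [v w]; have -> : 'd phi (x, f x) = _ :> (_ -> _) := e.
by rewrite -[LHS]/(eta0 w + 'd Q x v + 0) addr0 addrC.
Qed.

Lemma graph_onE z : (U `*` setT) z ->
  graph_on U f z <-> (~` [set z : V * W | U z.1 /\ z.2 <> f z.1]) z.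
Proof.
by move=> [Uz _]; split=> [[_ zE] [_ []]//|nz]; split=> //; apply: contrapT => zE; apply: nz.
Qed.

Lemma phi0 : phi (x, f x) = 0.
Proof. by rewrite /phi /c /= subrr. Qed.

(** On the graph, the test function [phi] takes the value [psi y - psi x] over [y]. *)
Lemma graph_propagates_near (B : set V) : nbhs x B ->
  exists y, [/\ B y, U y & psi y < psi x].
Proof.
move=> xB.
have B' : nbhs (x, f x) [set z : V * W | B z.1].
  by have: fst @ (x, f x) --> x; [exact: cvg_fst | apply].
have [y [By [Uy yE] ny]] := propagates_near graph_rel_closed graph_onE
    (p := (x, f x)) (conj Ux erefl) (N := N) (conj Ux I)
    (smooth_expr_smooth_on smooth_test) phi0 diff_test prop_x B'.
exists y.1; split=> //.
by move: ny; rewrite /phi /c yE subr_lt0.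
Qed.

(** The locally constant function equal to 1 on [S] and to 0 on [S'] extends to the
    graph over a ball around [x]; balls are connected, so the extension is constant
    and only one of the two values can occur. *)
Lemma graph_propagates_side (B S S' : set V) : nbhs x B -> open S -> open S' ->
    (forall y, B y -> U y -> psi y < psi x -> S y \/ S' y) ->
    (forall y, B y -> U y -> psi y < psi x -> S y -> ~ S' y) ->
  (\forall y \near x, U y -> psi y < psi x -> ~ S y) \/
  (\forall y \near x, U y -> psi y < psi x -> ~ S' y).
Proof.
move=> xB oS oS' cov disj.
have cyl (G : set V) : open G -> open [set z : V * W | G z.1].
  by move=> oG; apply: open_comp => // z _; apply: cont_fst.
have B' : nbhs (x, f x) [set z : V * W | B z.1].
  by have: fst @ (x, f x) --> x; [exact: cvg_fst | apply].
have [|[y w] /= By [/= Uy ->] ny|O' [w [oO' xO' wloc wS wS']]] :=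
    propagates_extension graph_rel_closed graph_onE
    (p := (x, f x)) (N := N) (conj Ux I)
    (smooth_expr_smooth_on smooth_test) phi0 diff_test prop_x B' (cyl _ oS) (cyl _ oS').
- move=> [y w] /= By [/= Uy wE] ny; apply: cov => //.
  by move: ny; rewrite /phi /c /= wE subr_lt0.
- by apply: disj => //; move: ny; rewrite /phi /c /= subr_lt0.
have : \forall y \near x, U y /\ O' (y, f y).
  apply: filterI; first exact: open_nbhs_nbhs.
  by apply: (graph_map_continuous_at Ux); apply: open_nbhs_nbhs.
move=> /nbhs_ballP[r /= r0 rU].
pose g y := w (y, f y).
have gloc y : ball x r y -> \forall z \near y, ball x r z -> g z = g y.
  move=> xy; have [Uy Oy] := rU y xy.
  have := graph_map_continuous_at Uy (wloc _ Oy (conj Uy erefl)).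
  by apply: (@filterS _ (nbhs y)) => z wz xz; apply: wz; split=> //; case: (rU z xz).
have oball : open (ball x r) by apply: ball_open.
have near_ball y : ball x r y -> nbhs y (ball x r).
  by move=> xy; apply: open_nbhs_nbhs.
have gconst y : ball x r y -> g y = g x.
  move=> xy; have [||||| sub|sub] := @connected_split _ (ball x r)
    [set z | ball x r z /\ g z = g x] [set z | ball x r z /\ g z <> g x].
  - exact: ball_connected.
  - rewrite openE => z [xz gz].
    apply: (@filterS2 _ (nbhs z) _ _ _ _ _ (near_ball z xz) (gloc z xz)).
    by move=> u xu gu; split=> //; rewrite gu.
  - rewrite openE => z [xz gz].
    apply: (@filterS2 _ (nbhs z) _ _ _ _ _ (near_ball z xz) (gloc z xz)).
    by move=> u xu gu; split=> //; rewrite gu.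
  - by move=> z xz; have [|] := pselect (g z = g x); [left|right].
  - by move=> z xz [_ ?] [_].
  - by have [] := sub y xy.
  - by have [] := sub x (ballxx x r0).
have neg y : psi y < psi x -> phi (y, f y) < 0 by rewrite /phi /c /= subr_lt0.
have xr : nbhs x (ball x r) by apply: near_ball; apply: ballxx.
have [g1|g0] := pselect (g x = 1); [right|left];
  apply: (@filterS _ (nbhs x) _ _ _ _ xr) => y xy Uy ny Sy; have [_ Oy] := rU y xy.
- have := wS' _ Oy (conj Uy erefl) (neg y ny) Sy; rewrite -/(g y) gconst // g1.
  by move/eqP; rewrite oner_eq0.
- by apply: g0; rewrite -(gconst y xy); apply: wS => //; exact: neg.
Qed.

End GraphPropagation.
(** * Finite-dimensional normed spaces *)

Section FiniteDimension.
Variables (R : realType) (E : normedModType R).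

Lemma rV_entry_le n (u : 'rV[R]_n) i : `|u ord0 i| <= `|u|.
Proof.
rewrite [leRHS]/Num.norm /= mx_normrE.
by apply/bigmax_geP; right => /=; exists (ord0, i).
Qed.

Lemma rV_norm_le n (u : 'rV[R]_n) M : 0 <= M -> (forall i, `|u ord0 i| <= M) -> `|u| <= M.
Proof.
move=> M0 uM; rewrite [leLHS]/Num.norm /= mx_normrE; apply: bigmax_le => // -[i j] _ /=.
by rewrite ord1.
Qed.

Lemma bounded_linear_form_continuous (l : {linear E -> R^o}) C :
  (forall x, `|l x| <= C * `|x|) -> continuous l.
Proof.
move=> lC; apply/linear_bounded_continuous/linear_boundedP.
apply: filterS (nbhs_pinfty_ge (num_real C)) => r Cr x.
by rewrite (le_trans (lC x)) // ler_wpM2r.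
Qed.

(** Continuous coordinates: a linear isomorphism from the standard space is
    bounded below on the unit sphere, which is compact. *)
Lemma finite_dim_coordinates : finite_dim E ->
  exists (n : nat) (e : 'I_n -> E) (X : 'I_n -> {linear E -> R^o}),
    (forall x, x = \sum_i X i x *: e i) /\ forall i, continuous (X i).
Proof.
move=> [n [g [h gK hK]]].
pose e i := g (delta_mx ord0 i).
have gE u : g u = \sum_i u ord0 i *: e i.
  rewrite [u in LHS]row_sum_delta linear_sum; apply: eq_bigr => i _.
  by rewrite linearZ.
have cg : continuous g.
  move=> u; rewrite /continuous_at.
  have -> : (g : _ -> _) = (fun u => \sum_i u ord0 i *: e i) by apply/funext.
  have := (@cvg_big E 'I_n +%R 0 xpredT (@add_continuous E) _ (nbhs u) (index_enum _)
    (fun i (u : 'rV_n) => u ord0 i *: e i) (fun i => u ord0 i *: e i)).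
  apply=> i _.
  by apply: cvgZr_tmp; apply: coord_continuous.
have [m m0 mP] : exists2 m, 0 < m & forall u : 'rV[R]_n, m * `|u| <= `|g u|.
  pose S := [set u : 'rV[R]_n | `|u| = 1].
  have [S0|nS] := pselect (S !=set0); last first.
    exists 1 => // u; rewrite mul1r; have [->|u0] := eqVneq u 0; first by rewrite normr0.
    case: nS; exists (`|u|^-1 *: u).
    by rewrite /S /= normrZ normfV normr_id mulVf ?normr_eq0.
  have cS : compact S.
    apply: bounded_closed_compact.
      by exists 1; split=> // r r1 u /= ->; apply: ltW.
    have -> : S = (fun u : 'rV[R]_n => `|u|) @^-1` [set 1] by [].
    by apply: closed_comp => [u _|]; [exact: norm_continuous|exact: closed_eq].
  have [u uS umin] := @compact_EVT_min _ R (fun u => `|g u|) S S0 cS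
    (continuous_subspaceT (fun u => cvg_norm (cg u))).
  rewrite inE in uS; exists `|g u|.
    rewrite normr_gt0; apply/eqP => gu0; have := uS; rewrite /S /= -(gK u) gu0.
    by rewrite -(raddf0 g) gK normr0 => /esym/eqP; rewrite oner_eq0.
  move=> w; have [->|w0] := eqVneq w 0; first by rewrite normr0 mulr0.
  have := umin (`|w|^-1 *: w); rewrite inE /S /= normrZ normfV normr_id mulVf ?normr_eq0 //.
  move=> /(_ erefl); rewrite linearZ normrZ normfV normr_id mulrC.
  by rewrite ler_pdivlMr ?normr_gt0.
have hlin : linear h by exact: (can2_linear gK hK).
have Xlin i : linear (fun x => h x ord0 i : R^o).
  by move=> a x y; rewrite hlin !mxE.
pose X i : {linear E -> R^o} :=
  HB.pack (fun x => h x ord0 i : R^o) (GRing.isLinear.Build R E R^o *:%R _ (Xlin i)).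
exists n, e, X; split=> [x|i]; first by rewrite -[LHS]hK gE.
apply: (@bounded_linear_form_continuous (X i) m^-1) => x.
rewrite (le_trans (rV_entry_le _ i)) // ler_pdivlMl //.
by rewrite -[x in leRHS]hK.
Qed.

Section Coordinates.
Variables (n : nat) (e : 'I_n -> E) (X : 'I_n -> {linear E -> R^o}).
Hypotheses (eX : forall x, x = \sum_i X i x *: e i) (cX : forall i, continuous (X i)).

Lemma coordinates_form_continuous (l : {linear E -> R^o}) : continuous l.
Proof.
have lE x : l x = \sum_i X i x *: l (e i).
  by rewrite [x in LHS]eX linear_sum; apply: eq_bigr => i _; rewrite linearZ.
move=> x; rewrite /continuous_at.
have -> : (l : _ -> _) = (fun x => \sum_i X i x *: l (e i)) by apply/funext.
have := (@cvg_big R^o 'I_n +%R 0 xpredT (@add_continuous R^o) _ (nbhs x) (index_enum _)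
  (fun i (x : E) => X i x *: l (e i)) (fun i => X i x *: l (e i))).
by apply=> i _; apply: cvgZr_tmp; apply: cX.
Qed.

Lemma coordinates_compact (A : set E) M : closed A ->
  (forall x, A x -> forall i, `|X i x| <= M) -> compact A.
Proof.
move=> cA AM; pose g (u : 'rV[R]_n) := \sum_i u ord0 i *: e i.
have cg : continuous g.
  move=> u.
  have := (@cvg_big E 'I_n +%R 0 xpredT (@add_continuous E) _ (nbhs u) (index_enum _)
    (fun i (u : 'rV_n) => u ord0 i *: e i) (fun i => u ord0 i *: e i)).
  by apply=> i _; apply: cvgZr_tmp; apply: coord_continuous.
pose B := [set u : 'rV[R]_n | `|u| <= Num.max M 0].
have cB : compact B.
  apply: bounded_closed_compact.
    exists (Num.max M 0); split; first by rewrite num_real.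
    by move=> r Mr u /= uM; apply: le_trans uM (ltW Mr).
  have -> : B = (fun u : 'rV[R]_n => `|u|) @^-1` [set r | r <= Num.max M 0] by [].
  by apply: closed_comp => [u _|]; [exact: norm_continuous|exact: closed_le].
apply: (subclosed_compact cA (continuous_compact (continuous_subspaceT cg) cB)).
move=> x Ax; exists (\row_i X i x).
  apply: rV_norm_le => [|i]; first by rewrite le_max lexx orbT.
  by rewrite mxE le_max AM.
by rewrite /g [RHS]eX; apply: eq_bigr => i _; rewrite mxE.
Qed.

End Coordinates.

Lemma finite_dim_form_continuous (l : {linear E -> R^o}) : finite_dim E -> continuous l.
Proof.
move=> /finite_dim_coordinates[n [e [X [eX cX]]]].
exact: coordinates_form_continuous eX cX _.
Qed.

(** A longitudinal coordinate [l] along [v] and a squared distance [q] to the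
    line spanned by [v], smooth and proper together. *)
Lemma line_coordinates (v : E) : finite_dim E -> v <> 0 ->
  exists (l : {linear E -> R^o}) (q : E -> R^o),
  [/\ l v = 1, continuous l, smooth_expr q
    & [/\ forall x, 0 <= q x, forall x t, q (x + t *: v) = q x, q 0 = 0,
          forall x, q x = 0 -> x = l x *: v
        & forall (A : set E) M, closed A ->
            (forall x, A x -> `|l x| <= M /\ q x <= M) -> compact A]].
Proof.
move=> /[dup] fE /finite_dim_coordinates[n [e [X [eX cX]]]] v0.
have [i0 Xv] : exists i, X i v != 0.
  apply: contrapT => nX; apply: v0; rewrite [v]eX big1 // => i _.
  have [->|Xi] := eqVneq (X i v) 0; first by rewrite scale0r.
  by case: nX; exists i.
have l_lin : linear (fun x => (X i0 v)^-1 * X i0 x : R^o).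
  by move=> a x y; rewrite linearP mulrDr -[_ *: _ in LHS]/(_ * _) mulrCA.
pose l : {linear E -> R^o} :=
  HB.pack (fun x => (X i0 v)^-1 * X i0 x : R^o) (GRing.isLinear.Build R E R^o *:%R _ l_lin).
have lv : l v = 1 by rewrite /= mulVf.
have Y_lin i : linear (fun x => X i x - l x * X i v : R^o).
  move=> a x y; rewrite (linearP (X i)) (linearP l) -![_ *: _]/(_ * _).
  by rewrite mulrDl opprD addrACA -mulrA -mulrBr.
pose Y i : {linear E -> R^o} :=
  HB.pack (fun x => X i x - l x * X i v : R^o) (GRing.isLinear.Build R E R^o *:%R _ (Y_lin i)).
pose q x : R^o := \sum_i Y i x * Y i x.
have q0 x : 0 <= q x by apply: sumr_ge0 => i _; rewrite -expr2 sqr_ge0.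
have Yq i x : `|Y i x| <= Num.sqrt (q x).
  rewrite -sqrtr_sqr ler_sqrt // /q (bigD1 i) //= -expr2 lerDl.
  by apply: sumr_ge0 => j _; rewrite -expr2 sqr_ge0.
have XY i x : X i x = Y i x + l x * X i v by rewrite /= subrK.
exists l, q; split=> //.
- exact: finite_dim_form_continuous.
- by apply: smooth_sum => i; apply: smooth_mul; apply: smooth_lin; apply: finite_dim_form_continuous.
split=> //.
- move=> x t; apply: eq_bigr => i _; have -> // : Y i (x + t *: v) = Y i x.
  have Yv : Y i v = 0 by rewrite -[LHS]/(X i v - l v * X i v) lv mul1r subrr.
  by rewrite linearD linearZ Yv -[RHS]addr0; congr (_ + _); exact: mulr0.
- by rewrite /q big1 // => i _; rewrite linear0 mul0r.
- move=> x qx; apply/eqP; rewrite -subr_eq0; apply/eqP.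
  rewrite [LHS]eX big1 // => i _; have -> : X i (x - l x *: v) = Y i x.
    by rewrite linearB linearZ.
  by have := Yq i x; rewrite qx sqrtr0 normr_le0 => /eqP ->; rewrite scale0r.
- move=> A M cA AM; refine (coordinates_compact eX (M := Num.sqrt M + M * \sum_i `|X i v|) cA _).
  move=> x /AM[lM qM] i; have M0 : 0 <= M by apply: le_trans qM.
  rewrite XY (le_trans (ler_normD _ _)) // lerD //.
    by rewrite (le_trans (Yq i x)) // ler_sqrt.
  rewrite normrM ler_pM // (bigD1 i) //= lerDl.
  exact: sumr_ge0.
Qed.

End FiniteDimension.
(** * A mountain pass lemma *)

Section MountainPass.
Variables (R : realType) (V : normedModType R).
Variables (Omega K : set V) (psi chi l : V -> R) (alpha beta theta c1 : R).

(** The level is raised by [c] only where [chi] is positive. *)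
Definition sublevel (c : R) : set V := [set x | Omega x /\ psi x < theta + c * chi x].

Definition crossing (c : R) : Prop := exists C : set V,
  [/\ connected C, C `<=` sublevel c, exists2 x, C x & l x <= alpha
    & exists2 x, C x & beta <= l x].

Hypotheses (openO : open Omega) (psi_cont : forall x, Omega x \/ K x -> {for x, continuous psi}).
Hypotheses (chi_cont : continuous chi) (chi01 : forall x, 0 <= chi x <= 1).
Hypothesis chi_out : forall x, l x <= alpha \/ beta <= l x -> chi x = 0.
Hypothesis compactK : compact K.
Hypothesis KE : forall x, Omega x -> alpha <= l x <= beta -> K x.
Hypothesis K_strip : forall x, K x -> alpha <= l x <= beta.
Hypothesis K_side : forall x, K x -> ~ Omega x -> theta + c1 * chi x < psi x.
Hypotheses (not_crossing0 : ~ crossing 0) (crossing1 : crossing c1).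

Lemma sublevel_mono c c' : c <= c' -> sublevel c `<=` sublevel c'.
Proof.
move=> cc' x [Ox /lt_le_trans lt]; split=> //; apply: lt.
by rewrite lerD2l ler_wpM2r //; case/andP: (chi01 x).
Qed.

Lemma level_continuous c x : Omega x \/ K x ->
  {for x, continuous (fun y => psi y - (theta + c * chi y))}.
Proof.
move=> /psi_cont px; apply: cvgB; first exact: px.
by apply: cvgD; [exact: cvg_cst | apply: cvgM; [exact: cvg_cst | exact: chi_cont]].
Qed.

Lemma sublevel_open c : open (sublevel c).
Proof.
rewrite openE => x [Ox lx].
have cx := level_continuous (c := c) (or_introl Ox).
have : psi x - (theta + c * chi x) < 0 by rewrite subr_lt0.
move=> /(cvgr_lt _ cx) near_lt.
apply: (@filterS2 _ (nbhs x) _ _ _ _ _ (open_nbhs_nbhs (conj openO Ox)) near_lt).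
by move=> y Oy; rewrite subr_lt0.
Qed.

Lemma sublevel_lower c x : sublevel c x -> exists2 c', c' < c & sublevel c' x.
Proof.
move=> [Ox lx]; have /andP[chi0 chi1] := chi01 x.
(* Half of the gap suffices since [chi] is at most 1. *)
exists (c - (theta + c * chi x - psi x) / 2); first by lra.
split=> //; nra.
Qed.

(** What propagation of the test function gives at a point of the level [c], in terms
    of sublevel sets only. *)
Definition regular_point (c : R) (x : V) : Prop :=
  (forall B, nbhs x B -> exists2 y, B y & sublevel c y) /\
  (forall S S' : set V, open S -> open S' ->
     (forall y, sublevel c y -> S y \/ S' y) -> (forall y, S y -> ~ S' y) ->
     (\forall y \near x, sublevel c y -> ~ S y) \/
     (\forall y \near x, sublevel c y -> ~ S' y)).

(** At the first level [c] at which the sublevel set connects both ends, some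
    boundary point is not regular: otherwise the two open parts of the sublevel
    set at [c] would have disjoint neighborhoods still covering slightly higher
    sublevel sets. *)
Lemma mountain_pass : exists c x,
  [/\ 0 <= c <= c1, Omega x /\ alpha <= l x <= beta, psi x = theta + c * chi x
    & ~ regular_point c x].
Proof.
pose c := inf [set c | crossing c].
have crossing_ge0 c' : crossing c' -> 0 <= c'.
  move=> [C [cC CX Ca Cb]]; rewrite leNgt; apply/negP => c'0; apply: not_crossing0.
  by exists C; split=> //; apply: subset_trans CX (sublevel_mono (ltW c'0)).
have lbE : lbound [set c | crossing c] 0 by move=> c' /crossing_ge0.
have infE : has_inf [set c | crossing c] by split; [exists c1 | exists 0].
have c0 : 0 <= c by apply: lb_le_inf => //; exists c1.
have cc1 : c <= c1 by apply: ge_inf => //; exists 0.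
have below c' : c' < c -> ~ crossing c'.
  by move=> c'c Cc'; have := ge_inf infE.2 Cc'; rewrite leNgt c'c.
(* The points of the sublevel set that are connected to the low end strictly below
   the level [c]; as [c] is the infimum of the crossing levels, they do not reach the
   high end. *)
pose S := [set x | exists c', exists C : set V,
  [/\ c' < c, connected C, C `<=` sublevel c', C x & exists2 y, C y & l y <= alpha]].
pose S' := sublevel c `\` S.
have SX : S `<=` sublevel c.
  by move=> x [c' [C [c'c cC CX Cx _]]]; apply: (sublevel_mono (ltW c'c)); apply: CX.
have near_lower x : sublevel c x -> exists c' r,
    [/\ c' < c, 0 < r & ball x r `<=` sublevel c'].
  move=> /sublevel_lower[c' c'c Xx].
  have /nbhs_ballP[r r0 xr] := open_nbhs_nbhs (conj (@sublevel_open c') Xx).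
  by exists c', r.
have S_ball x c' r c'' C y : c' < c -> ball x r `<=` sublevel c' -> ball x r y ->
    c'' < c -> connected C -> C `<=` sublevel c'' -> C y -> (exists2 z, C z & l z <= alpha) ->
    ball x r `<=` S.
  move=> c'c xX xy c''c cC CX Cy [z Cz az] u xu.
  exists (Num.max c' c''), (ball x r `|` C); split.
  - by rewrite gt_max c'c.
  - by apply: connectedU => //; [exists y | exact: ball_connected].
  - move=> w [/xX|/CX]; apply: sublevel_mono; by rewrite le_max lexx ?orbT.
  - by left.
  - by exists z => //; right.
have oS : open S.
  rewrite openE => x Sx; have [c' [r [c'c r0 xX]]] := near_lower x (SX x Sx).
  have [c'' [C [c''c cC CX Cx Ca]]] := Sx.
  by apply/nbhs_ballP; exists r => //; apply: (S_ball x c' r c'' C x) => //; apply: ballxx.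
have oS' : open S'.
  rewrite openE => x [Xx nSx]; have [c' [r [c'c r0 xX]]] := near_lower x Xx.
  apply/nbhs_ballP; exists r => // y xy; split; first exact: sublevel_mono (ltW c'c) _ (xX y xy).
  move=> [c'' [C [c''c cC CX Cy Ca]]]; apply: nSx.
  by apply: (S_ball x c' r c'' C y) => //; apply: ballxx.
have SS' y : S y -> ~ S' y by move=> Sy [].
have covS y : sublevel c y -> S y \/ S' y.
  by move=> Xy; have [Sy|nSy] := pselect (S y); [left | right].
have S_low x : sublevel c x -> l x <= alpha -> S x.
  move=> /sublevel_lower[c' c'c Xx] lx.
  exists c', [set x]; split=> //; [exact: connected1 | by move=> _ -> | by exists x].
have S'_high x : sublevel c x -> beta <= l x -> S' x.
  move=> Xx lx; split=> // -[c' [C [c'c cC CX Cx Ca]]].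
  by apply: (below c' c'c); exists C; split=> //; exists x.
apply: contrapT => allreg.
pose Z := [set x | [/\ Omega x, alpha <= l x <= beta & psi x = theta + c * chi x]].
have regZ x : Z x -> regular_point c x.
  move=> [Ox lx px]; apply: contrapT => nreg; apply: allreg.
  by exists c, x; rewrite c0 cc1.
(* Balls of half the radius of balls that avoid [A]: two such balls with centers on
   different sides cannot meet, since one of the centers would lie in the full ball
   around the other. *)
pose half (A : set V) : set V := \bigcup_(p in [set p : V * R |
  [/\ Z p.1, 0 < p.2 & forall y, ball p.1 p.2 y -> ~ A y]]) ball p.1 (p.2 / 2).
have half_open A : open (half A).
  by apply: bigcup_open => -[x r] [/= _ r0 _]; apply: ball_open; rewrite divr_gt0.
have half_out A y : half A y -> ~ A y.
  move=> [[x r] [/= _ r0 xA] xy]; apply: xA; apply: le_ball xy.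
  by rewrite /=; lra.
have half_disj y : half S y -> ~ half S' y.
  move=> [[x r] [/= Zx r0 xS] xy] [[x' r'] [/= Zx' r'0 xS'] xy'].
  move: xy xy'; rewrite -ball_normE /= => xy xy'.
  have xx' : `|x - x'| < r / 2 + r' / 2.
    by rewrite -[x](subrK y) -addrA (le_lt_trans (ler_normD _ _)) // ltrD // distrC.
  have contact z s z' s' (A A' : set V) : Z z' -> 0 < s' ->
      (forall y, ball z s y -> ~ A y) -> (forall y, ball z' s' y -> ~ A' y) ->
      (forall y, sublevel c y -> A y \/ A' y) -> ball z s z' -> False.
    move=> Zz' s'0 zA zA' cov zz'.
    have := (regZ z' Zz').1 (ball z s `&` ball z' s').
    case.
      apply: filterI; last exact: nbhsx_ballx.
      by apply: open_nbhs_nbhs; split=> //; apply: ball_open; apply: ball_gt0 zz'.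
    by move=> w [zw z'w] /cov[]; [exact: zA | exact: zA'].
  have [rr'|r'r] := leP r r'.
  - apply: (contact x' r' x r S' S) => // [w|]; first by move=> /covS[]; [right|left].
    by rewrite -ball_normE /= distrC (lt_le_trans xx') //; lra.
  - apply: (contact x r x' r' S S') => //.
    by rewrite -ball_normE /= (lt_le_trans xx') //; lra.
pose O1 := S `|` half S'; pose O0 := S' `|` half S.
have disj y : O1 y -> ~ O0 y.
  move=> [Sy|hy] [S'y|hy']; first exact: SS' S'y.
  - exact: half_out hy' Sy.
  - exact: half_out hy S'y.
  - exact: half_disj hy' hy.
have ZO x : Z x -> O1 x \/ O0 x.
  move=> Zx; have [xS|xS] := (regZ x Zx).2 S S' oS oS' covS SS'.
  - have /nbhs_ballP[r r0 xr] := xS; right; right; exists (x, r).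
      split=> //= y xy Sy; exact: xr xy (SX y Sy) Sy.
    by apply: ballxx; rewrite divr_gt0.
  - have /nbhs_ballP[r r0 xr] := xS; left; right; exists (x, r).
      split=> //= y xy S'y; exact: xr xy (S'y.1) S'y.
    by apply: ballxx; rewrite divr_gt0.
(* On the compact rest of [K], [psi] stays above the level [c] by some margin. *)
have [d d0 dO] : exists2 d, 0 < d & forall x, sublevel (c + d) x -> O1 x \/ O0 x.
  pose K' := K `&` ~` (O1 `|` O0).
  have oO : open (O1 `|` O0) by do !apply: openU.
  have cK' : compact K' by apply: compact_closedI => //; apply: open_closedC.
  have [m m0 mP] : exists2 m, 0 < m & forall x, K' x -> m <= psi x - (theta + c * chi x).
    have [K0|nK] := pselect (K' !=set0); last by exists 1 => // x Kx; case: nK; exists x.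
    have cont : {within K', continuous (fun y => psi y - (theta + c * chi y))}.
      apply: continuous_in_subspaceT => x; rewrite inE => -[Kx _].
      by apply: level_continuous; right.
    have [x] := @compact_EVT_min _ R _ K' K0 cK' cont; rewrite inE => -[Kx nO] xmin.
    exists (psi x - (theta + c * chi x)); last by move=> y Ky; apply: xmin; rewrite inE.
    rewrite subr_gt0; have /andP[chi0 _] := chi01 x.
    have [Ox|nOx] := pselect (Omega x); last first.
      apply: le_lt_trans (K_side Kx nOx); by rewrite lerD2l ler_wpM2r.
    rewrite lt_neqAle; apply/andP; split.
      by apply/eqP => e; apply/nO/ZO; split=> //; apply: K_strip.
    rewrite leNgt; apply/negP => lt; apply: nO.
    by have [|] := covS x (conj Ox lt); [left; left | right; left].
  exists m => // x [Ox lx]; apply: contrapT => nO.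
  have nX : ~ sublevel c x by move=> /covS[?|?]; apply: nO; [left; left|right; left].
  have [lr|nlr] := boolP (alpha <= l x <= beta).
    have Kx : K' x by split; [exact: KE | move=> [?|?]; apply: nO; [left|right]].
    have := mP x Kx; have /andP[chi0 chi1] := chi01 x; nra.
  apply: nX; split=> //; move: lx; rewrite chi_out ?mulr0 //.
  by move: nlr; rewrite negb_and -!ltNge => /orP[]/ltW; [left|right].
have [c2 Cc2 c2d] := inf_adherent d0 infE.
have [C [cC CX [y Cy ly] [z Cz lz]]] := Cc2.
have CX' : C `<=` sublevel (c + d) := subset_trans CX (sublevel_mono (ltW c2d)).
have Xend w : C w -> l w <= alpha \/ beta <= l w -> sublevel c w.
  by move=> /CX'[Ow lw] ew; split=> //; move: lw; rewrite chi_out ?mulr0.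
have [||||CO|CO] := @connected_split _ C O1 O0 cC.
- exact: openU.
- exact: openU.
- by move=> w /CX'/dO.
- by move=> w _; apply: disj.
- apply: (disj z (CO z Cz)); left; apply: S'_high => //; apply: Xend => //; by right.
- have S1 : O1 y by left; apply: S_low => //; apply: Xend => //; left.
  exact: disj S1 (CO y Cy).
Qed.

End MountainPass.
(** * Approximate critical points *)

Section OneVariable.
Variable R : realType.

Lemma smooth_continuous (E : normedModType R) (g : E -> R^o) : smooth_expr g -> continuous g.
Proof. by move=> sg x; apply/differentiable_continuous/smooth_expr_differentiable. Qed.

Lemma smooth_id : smooth_expr (fun t : R^o => t).
Proof. by apply: (@smooth_lin R R^o idfun) => t; apply: cvg_id. Qed.

Lemma smooth_is_derive (g : R^o -> R^o) : smooth_expr g -> exists dg : R^o -> R^o,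
  continuous dg /\ forall t, is_derive (t : R) 1 (g : R -> R) (dg t).
Proof.
move=> /smooth_expr_diff[dg [dgP dgS]]; exists (fun t => dg t 1); split.
  exact: smooth_continuous.
move=> t; have [gt gE] := dgP t; apply: DeriveDef; first exact: diff_derivable.
by rewrite deriveE // gE.
Qed.

Lemma flat1_le1 (t : R) : 0 <= flat 1 t <= 1.
Proof.
have [t0|t0] := ltP 0 t; last by rewrite flat_npos // lexx ler01.
by rewrite flat_pos // hornerC mul1r expR_ge0 expR_le1 oppr_le0 invr_ge0 ltW.
Qed.

(** [flat 1] of a quadratic polynomial that is positive exactly on ]d, 1 - d[. *)
Lemma smooth_bump (d : R) : 0 < d -> 4 * d <= 1 -> exists (chi dchi : R^o -> R^o) (c0 M : R),
  [/\ smooth_expr chi, forall t, 0 <= chi t <= 1,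
      forall t, t <= d \/ 1 - d <= t -> chi t = 0,
      0 < c0 /\ forall t, 2 * d <= t <= 1 - 2 * d -> c0 <= chi t
    & [/\ forall t, is_derive (t : R) 1 (chi : R -> R) (dchi t),
          0 <= M & forall t, 0 <= t <= 1 -> `|dchi t| <= M]].
Proof.
move=> d0 d4; pose s (t : R^o) : R^o := (t + - d) * ((1 - d) + (-1) * t).
have sms : smooth_expr s.
  apply: smooth_mul; first by apply: smooth_add; [exact: smooth_id|exact: smooth_cst].
  apply: smooth_add; first exact: smooth_cst.
  by apply: smooth_mul; [exact: smooth_cst|exact: smooth_id].
have smchi : smooth_expr (fun t => flat 1 (s t)) by exact: smooth_flat.
have [dchi [dchi_cont dchiP]] := smooth_is_derive smchi.
have [|t _ tmax] := @EVT_max R (fun t => `|dchi t|) 0 1 ler01.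
  by apply: continuous_subspaceT => t; apply: cvg_norm; apply: dchi_cont.
have [||u] := @EVT_min R (fun t => flat 1 (s t)) (2 * d) (1 - 2 * d); first lra.
  exact/continuous_subspaceT/smooth_continuous.
rewrite in_itv /= => /andP[du ud] umin.
exists (fun t => flat 1 (s t)), dchi, (flat 1 (s u)), `|dchi t|; split=> //.
- by move=> w; apply: flat1_le1.
- move=> w wd; apply: flat_npos; rewrite /s.
  by have [?|?] := wd; [apply: mulr_le0_ge0 | apply: mulr_ge0_le0]; lra.
- split; last by move=> w wd; apply: umin; rewrite in_itv.
  by apply: flat1_gt0; rewrite /s; apply: mulr_gt0; lra.
Qed.

End OneVariable.

Section LineDeformation.
Variables (k : comNzRingType) (R : realType) (V W : normedModType R).
Variables (U : set V) (f : V -> W) (a b : V) (eta0 : dual W).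
Hypotheses (openU : open U) (contf : {within U, continuous f}).
Hypotheses (cont_eta0 : continuous eta0) (abU : segment a b `<=` U).
Local Notation v := (b - a).
Variables (l : {linear V -> R^o}) (q : V -> R^o).
Hypotheses (lv : l v = 1) (cl : continuous l) (smq : smooth_expr q).
Hypotheses (q_ge0 : forall x, 0 <= q x) (q_line : forall x t, q (x + t *: v) = q x)
  (q0 : q 0 = 0) (q_eq0 : forall x, q x = 0 -> x = l x *: v)
  (lq_compact : forall (A : set V) M, closed A ->
     (forall x, A x -> `|l x| <= M /\ q x <= M) -> compact A).

Let L (x : V) : R^o := l (x - a).
Let D (x : V) : R^o := q (x - a).
Let m : R := eta0 (f b - f a).
Let line (t : R) : V := a + t *: v.
Let h (t : R) : R := eta0 (f (line t)) - eta0 (f a) - t * m.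
Local Notation F := (const_sheaf k (U `*` setT) (graph_on U f)).

Lemma L_line t : L (line t) = t.
Proof. by rewrite /L /line addrC addKr linearZ lv; exact: mulr1. Qed.

Lemma D_line t : D (line t) = 0.
Proof. by rewrite /D /line addrC addKr -[_ *: _]add0r q_line. Qed.

Lemma line_U t : 0 <= t <= 1 -> U (line t).
Proof. by move=> t01; apply: abU; exists t. Qed.

Lemma line_continuous : continuous line.
Proof. exact: segment_continuous. Qed.


Lemma smooth_shift (g : V -> R^o) : smooth_expr g -> smooth_expr (fun x => g (x - a)).
Proof.
move=> sg; have := @smooth_expr_comp R V V idfun (- a) g _ sg; apply.
by move=> x; apply: cvg_id.
Qed.

Lemma D_ge0 x : 0 <= D x. Proof. exact: q_ge0. Qed.

Lemma L_continuous : continuous L.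
Proof. exact/smooth_continuous/smooth_shift/smooth_lin. Qed.

Lemma D_continuous : continuous D.
Proof. exact/smooth_continuous/smooth_shift. Qed.

Definition test (N : R) (B : R^o -> R^o) (x : V) : R^o := N * D x + B (L x).

Lemma smooth_test_line N B : smooth_expr B -> smooth_expr (test N B).
Proof.
move=> sB; apply: smooth_add.
  by apply: smooth_mul; [exact: smooth_cst | exact: smooth_shift].
have := smooth_expr_comp (- l a : R^o) cl sB.
by congr smooth_expr; apply/funext => x; rewrite /L linearB.
Qed.

(** The penalty does not contribute, because [D] is constant along the line. *)
Lemma diff_test_line N B x dB : smooth_expr B -> is_derive (L x : R) 1 (B : R -> R) dB ->
  'd (test N B) x v = dB.
Proof.
move=> sB [_ <-]; rewrite -deriveE; last exact/smooth_expr_differentiable/smooth_test_line.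
suff E : (fun t : R => t^-1 *: ((test N B \o shift x) (t *: v) - test N B x)) =
    (fun t : R => t^-1 *: ((B \o shift (L x)) (t *: (1 : R)) - B (L x))).
  by rewrite /derive E.
apply/funext => t /=; congr (_ *: _).
have E : t *: v + x - a = x - a + t *: v by rewrite -addrA addrC.
rewrite /test /D /L E q_line linearD linearZ lv opprD addrACA subrr add0r.
by congr (B _ - _); exact: addrC.
Qed.

Lemma tube_closed alpha beta r : closed [set x | alpha <= L x <= beta /\ D x <= r].
Proof.
have -> : [set x | alpha <= L x <= beta /\ D x <= r] =
    L @^-1` [set t | alpha <= t] `&` (L @^-1` [set t | t <= beta] `&` D @^-1` [set t | t <= r]).
  by apply/seteqP; split=> [x [/andP[? ?] ?]|x [? [? ?]]] //; split=> //; apply/andP.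
apply: closedI; first by apply: closed_comp => [x _|]; [exact: L_continuous | exact: closed_ge].
apply: closedI; first by apply: closed_comp => [x _|]; [exact: L_continuous | exact: closed_le].
by apply: closed_comp => [x _|]; [exact: D_continuous | exact: closed_le].
Qed.

(** Compactness is translated from the origin to [a]. *)
Lemma tube_compact alpha beta r : compact [set x | alpha <= L x <= beta /\ D x <= r].
Proof.
pose T := [set y | exists2 x, alpha <= L x <= beta /\ D x <= r & y = x - a].
have cT : compact T.
  apply: (@lq_compact _ (Num.max (Num.max `|alpha| `|beta|) r)).
    have -> : T = (fun y => y + a) @^-1` [set x | alpha <= L x <= beta /\ D x <= r].
      apply/seteqP; split=> [y [x xP ->]|y yP]; first by rewrite /= subrK.
      by exists (y + a); rewrite ?addrK.
    apply: closed_comp => [x _|]; last exact: tube_closed.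
    by apply: cvgD; [exact: cvg_id | exact: cvg_cst].
  move=> _ [x [/andP[La Lb] Dr] ->]; split; last by rewrite le_max Dr orbT.
  rewrite le_max; apply/orP; left; rewrite ler_norml; apply/andP; split.
    rewrite lerNl (le_trans _ (_ : `|alpha| <= _)) ?le_max ?lexx //.
    by rewrite lerNl (le_trans _ La) // lerNl ler_normr lexx orbT.
  by rewrite (le_trans Lb) // (le_trans (ler_norm beta)) // le_max lexx orbT.
have -> : [set x | alpha <= L x <= beta /\ D x <= r] = (fun y => y + a) @` T.
  apply/seteqP; split=> [x xP|_ [_ [x xP ->] <-]]; last by rewrite /= subrK.
  by exists (x - a); rewrite ?subrK //; exists x.
apply: continuous_compact cT; apply: continuous_subspaceT => x.
by apply: cvgD; [exact: cvg_id | exact: cvg_cst].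
Qed.

Lemma D_eq0 x : D x = 0 -> x = line (L x).
Proof. by move=> /q_eq0 e; rewrite /line /L -e addrC subrK. Qed.

(** On the compact part of a unit tube outside the interior of [P], the squared
    distance [D] to the line has a positive minimum. *)
Lemma thin_tube alpha beta (P : set V) :
  (forall t, alpha <= t <= beta -> nbhs (line t) P) ->
  exists2 r, 0 < r & forall x, alpha <= L x <= beta -> D x <= r -> P x.
Proof.
move=> nP; pose T := [set x | alpha <= L x <= beta /\ D x <= 1] `&` ~` interior P.
have cT : compact T.
  by apply: compact_closedI; [exact: tube_compact | apply/open_closedC/open_interior].
have [T0|nT] := pselect (T !=set0); last first.
  exists 1 => // x Lx Dx; apply: interior_subset; apply: contrapT => nx.
  by apply: nT; exists x.
have cD : {within T, continuous (D : V -> R)} by apply/continuous_subspaceT/D_continuous.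
have [x] := @compact_EVT_min _ R (D : V -> R) T T0 cT cD; rewrite inE => -[[Lx Dx] nx] xmin.
have Dpos : 0 < D x.
  rewrite lt_neqAle D_ge0 andbT; apply/eqP => /esym/D_eq0 e.
  by apply: nx; rewrite e; apply: nP.
exists (D x / 2) => [|y Ly Dy]; first by rewrite divr_gt0.
apply: interior_subset; apply: contrapT => ny.
have Ty : T y by split=> //; split=> //; lra.
by have := xmin y (mem_set Ty); lra.
Qed.

Lemma eta_f_continuous x : U x -> {for x, continuous (fun y => eta0 (f y))}.
Proof.
move=> Ux; apply: continuous_comp; first exact: (open_continuous_at openU contf).
exact: cont_eta0.
Qed.

Lemma potential_continuous N B x : smooth_expr B -> U x ->
  {for x, continuous (fun y => eta0 (f y) + test N B y : R)}.
Proof.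
move=> sB Ux; apply: cvgD; first exact: eta_f_continuous.
exact/smooth_continuous/smooth_test_line.
Qed.

(** Thin tubes around a piece of the segment lie in [U] and stay close to it. *)
Lemma near_line_tube t eps : 0 <= t <= 1 -> 0 < eps ->
  \forall x \near line t, U x /\ `|x - line (L x)| <= eps.
Proof.
move=> t01 eps0; apply: filterI.
  by apply: open_nbhs_nbhs; split=> //; apply: line_U.
have dist_cont : (`|x - line (L x)|) @[x --> line t] --> `|line t - line (L (line t))|.
  apply: cvg_norm; apply: cvgB; first exact: cvg_id.
  by apply: continuous_comp; [exact: L_continuous | exact: line_continuous].
have : `|line t - line (L (line t))| < eps by rewrite L_line subrr normr0.
by move=> /(cvgr_lt _ dist_cont); apply: filterS => x /ltW.
Qed.

Lemma line_tube alpha beta r t : alpha <= t <= beta -> 0 < r ->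
  alpha <= L (line t) <= beta /\ D (line t) <= r.
Proof. by move=> tab r0; rewrite L_line D_line; split=> //; exact: ltW. Qed.

(** A large penalty lifts the lateral boundary of a tube above any given level. *)
Lemma large_penalty (G : V -> R) alpha beta r level : 0 < r ->
    (forall x, alpha <= L x <= beta -> D x <= r -> {for x, continuous G}) ->
  exists2 N, 0 <= N & forall x, alpha <= L x <= beta -> D x = r -> level < G x + N * D x.
Proof.
move=> r0 cG; pose T := [set x | alpha <= L x <= beta /\ D x <= r].
have [T0|nT] := pselect (T !=set0); last first.
  by exists 0 => // x Lx Dx; case: nT; exists x; split=> //; rewrite Dx.
have cT : compact T := @tube_compact _ _ _.
have [z _ zmin] : exists2 z, z \in T & forall t, t \in T -> G z <= G t.
  apply: (@compact_EVT_min _ R G T T0 cT).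
  by apply: continuous_in_subspaceT => x; rewrite inE => -[Lx Dx]; apply: cG.
exists ((`|level - G z| + 1) / r); first by rewrite divr_ge0 ?addr_ge0 // ltW.
move=> x Lx Dx; have Tx : T x by split=> //; rewrite Dx.
rewrite Dx divfK ?gt_eqF //; have := zmin x (mem_set Tx).
by have := ler_norm (level - G z); lra.
Qed.

Let critical alpha beta eps := exists x (xi : dual V),
  [/\ U x, alpha <= L x <= beta, `|x - line (L x)| <= eps,
      `|xi v + m| <= eps & ~ propagates F (x, f x) (dual_pair xi eta0)].

(** Case of an interior minimum: after adding (t - t0)^2 the minimum along the
    line is strict, and a large penalty makes the minimum over a small tube
    interior to the tube. *)
Lemma approx_min t0 d eps : 0 < d -> 0 <= t0 - d -> t0 + d <= 1 -> 2 * d <= eps ->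
    (forall t, 0 <= t <= 1 -> h t0 <= h t) ->
  critical (t0 - d) (t0 + d) eps.
Proof.
move=> d0 t0d t0d1 deps hmin.
pose B (t : R^o) : R^o := - m * t + (t - t0) * (t - t0).
have smB : smooth_expr B.
  apply: smooth_add; first by apply: smooth_mul; [exact: smooth_cst | exact: smooth_id].
  by apply: smooth_mul; apply: smooth_add;
     [exact: smooth_id | exact: smooth_cst | exact: smooth_id | exact: smooth_cst].
have dB t : is_derive (t : R) 1 (B : R -> R) (- m + 2 * (t - t0)).
  apply: is_derive_eq.
  by rewrite /GRing.scale /=; ring.
pose G (x : V) : R := eta0 (f x) + test 0 B x.
have G_line t : G (line t) = h t + eta0 (f a) + (t - t0) ^+ 2.
  by rewrite /G /test D_line /B L_line /h; ring.
have end1 : 0 <= t0 - d <= 1 by apply/andP; split; lra.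
have end2 : 0 <= t0 + d <= 1 by apply/andP; split; lra.
have mid0 : t0 - d <= t0 <= t0 + d by apply/andP; split; lra.
have strip t : t0 - d <= t <= t0 + d -> 0 <= t <= 1.
  by case/andP=> t1 t2; rewrite (le_trans t0d t1) (le_trans t2 t0d1).
have eps0 : 0 < eps by lra.
have G_end t : 0 <= t <= 1 -> (t - t0) ^+ 2 = d ^+ 2 ->
    exists2 r, 0 < r & forall x, t <= L x <= t -> D x <= r -> G (line t0) < G x.
  move=> t1 tt; apply: (@thin_tube t t (fun x => G (line t0) < G x)) => s st.
  have -> : s = t by apply/eqP; rewrite eq_le andbC.
  have cG : {for line t, continuous G} := potential_continuous (N := 0) smB (line_U t1).
  apply: (cvgr_gt (G (line t)) cG); rewrite !G_line subrr expr0n addr0 tt.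
  by rewrite ltr_pwDr ?exprn_gt0 // lerD2r hmin.
have [r1 r10 r1P] := thin_tube (fun t td => near_line_tube (strip t td) eps0).
have [r2 r20 r2P] := G_end _ end1 ltac:(ring).
have [r3 r30 r3P] := G_end _ end2 ltac:(ring).
pose r := Num.min r1 (Num.min r2 r3).
have r0 : 0 < r by rewrite !lt_min r10 r20.
have [rr1 rr2 rr3] : [/\ r <= r1, r <= r2 & r <= r3].
  by split; rewrite !ge_min lexx ?orbT.
pose T := [set x | t0 - d <= L x <= t0 + d /\ D x <= r].
have TP x : T x -> U x /\ `|x - line (L x)| <= eps.
  by move=> [Lx Dx]; apply: r1P => //; apply: le_trans rr1.
have TU x : T x -> U x by case/TP.
have [N N0 NP] := @large_penalty G (t0 - d) (t0 + d) r (G (line t0)) r0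
  (fun x Lx Dx => potential_continuous (N := 0) smB (TU x (conj Lx Dx))).
pose psi (x : V) : R := eta0 (f x) + test N B x.
have psiE x : psi x = G x + N * D x by rewrite /psi /G /test; ring.
have [x] : exists2 x, x \in T & forall y, y \in T -> psi x <= psi y.
  apply: (@compact_EVT_min _ R psi T _ (@tube_compact _ _ _)).
    by exists (line t0); apply: line_tube.
  apply: continuous_in_subspaceT => y; rewrite inE => /TU.
  exact: potential_continuous.
rewrite inE => xT xmin; have [Lx Dx] := xT.
have x_le : psi x <= G (line t0).
  have -> : G (line t0) = psi (line t0) by rewrite psiE D_line mulr0 addr0.
  by apply: xmin; rewrite inE; apply: line_tube.
have GD : G x <= psi x by rewrite psiE lerDl mulr_ge0 ?D_ge0.
have Gx : ~ G (line t0) < G x by apply/negP; rewrite -leNgt (le_trans GD).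
(* On the lateral boundary the penalty lifts [psi] above its value at [line t0], and
   on the two ends the term [(t - t0)^2] does. *)
have Dlt : D x < r.
  rewrite lt_neqAle Dx andbT; apply/eqP => Dr.
  by have := NP x Lx Dr; rewrite -psiE ltNge x_le.
have Llt : t0 - d < L x < t0 + d.
  case/andP: Lx => L1 L2; rewrite !lt_neqAle L1 L2 !andbT; apply/andP; split; apply/eqP => e.
  - by apply/Gx/r2P; [rewrite -e lexx | exact: le_trans Dx rr2].
  - by apply/Gx/r3P; [rewrite e lexx | exact: le_trans Dx rr3].
have [Ux xline] := TP x xT.
exists x, ('d (test N B) x); split=> //.
- rewrite (diff_test_line N smB (dB (L x))) addrAC addNr add0r ler_norml.
  by case/andP: Llt => *; apply/andP; split; lra.
- move=> prop; case/andP: Llt => L1 L2.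
  have xT' : nbhs x T.
    have n1 : \forall y \near x, D y < r by exact: (cvgr_lt _ (D_continuous (x := x))).
    have n2 : \forall y \near x, L y < t0 + d by exact: (cvgr_lt _ (L_continuous (x := x))).
    have n3 : \forall y \near x, t0 - d < L y by exact: (cvgr_gt _ (L_continuous (x := x))).
    have n123 : \forall y \near x, [/\ D y < r, L y < t0 + d & t0 - d < L y].
      by near=> y; split; near: y.
    apply: (filterS _ n123) => y [y1 y2 y3].
    by split; rewrite ?ltW.
  have [y [Ty Uy]] := graph_propagates_near openU contf cont_eta0
    (smooth_test_line N smB) Ux prop xT'.
  by rewrite -/(psi y) -/(psi x) ltNge xmin // inE.
Unshelve. all: by end_near. Qed.

(** Case of a positive maximum H: the levels move from just below to just above H,
    but only over a bump [chi] supported in the interior of the segment, so that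
    the ends of the sublevel sets stay fixed. The slope that the bump adds along
    the line is of the order of the total change of level, hence negligible. *)
Lemma approx_max t1 d eps : 0 <= t1 <= 1 -> 0 < h t1 -> 0 < eps -> 0 < d -> 4 * d <= 1 ->
    (forall t, 0 <= t <= 1 -> h t <= h t1) ->
    (forall t, 0 <= t <= 1 -> t <= 2 * d \/ 1 - 2 * d <= t -> h t <= h t1 / 2) ->
  critical d (1 - d) eps.
Proof.
move=> t101 H0 eps0 d0 d4 hmax hends; set H := h t1.
have [chi [dchi [c0 [M [smchi chi01 chi_out [c00 c0P] [dchiP M0 MP]]]]]] := smooth_bump d0 d4.
(* The level rises from [H - e] by at most [c1 = 2 e / c0], which is enough to pass
   [H] where [chi] is at least [c0]; the slope of the bump is then at most [eps]. *)
have [e [epos eH c1M]] : exists e, [/\ 0 < e, e <= H / 4 & 2 * e / c0 * M <= eps].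
  exists (Num.min (H / 4) (eps * c0 / (2 * (M + 1)))).
  have M1 : 0 < M + 1 by rewrite ltr_wpDl.
  split; [by rewrite lt_min !divr_gt0 ?mulr_gt0 | by rewrite ge_min lexx |].
  set e := Num.min _ _; have : e <= eps * c0 / (2 * (M + 1)) by rewrite ge_min lexx orbT.
  rewrite ler_pdivlMr ?mulr_gt0 // => eM.
  have e0 : 0 <= e by rewrite le_min !divr_ge0 ?mulr_ge0 ?ltW.
  rewrite mulrAC ler_pdivrMr // (le_trans _ eM) //.
  by rewrite [2 * e]mulrC -mulrA ler_wpM2l // ler_wpM2l // lerDl.
pose c1 := 2 * e / c0; pose theta := H - e.
have c1_ge0 : 0 <= c1 by rewrite divr_ge0 ?mulr_ge0 ?ltW.
have c1c0 : c1 * c0 = 2 * e by rewrite /c1 divfK ?gt_eqF.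
have thetaH : theta < H by rewrite /theta ltrBlDr ltrDl.
have H2 : H / 2 < theta by rewrite /theta; lra.
have [t1d td1] : 2 * d < t1 /\ t1 < 1 - 2 * d.
  have Hhalf : H / 2 < H by lra.
  have interior : ~ (t1 <= 2 * d \/ 1 - 2 * d <= t1).
    by move=> /(hends t1 t101); rewrite -/H leNgt Hhalf.
  by split; rewrite ltNge; apply/negP => t1d; apply: interior; [left|right].
have [dt1 t1d'] : d < t1 /\ t1 < 1 - d by split; lra.
have strip t : d <= t <= 1 - d -> 0 <= t <= 1 by move=> /andP[? ?]; apply/andP; split; lra.
pose B0 (t : R^o) : R^o := (- m) * t + - eta0 (f a).
have smB0 : smooth_expr B0.
  by apply: smooth_add; [apply: smooth_mul; [exact: smooth_cst|exact: smooth_id]|exact: smooth_cst].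
pose G (x : V) : R := eta0 (f x) + test 0 B0 x.
have G_line t : G (line t) = h t by rewrite /G /test D_line /B0 L_line /h; ring.
have [r1 r10 r1P] := thin_tube (fun t td => near_line_tube (strip t td) eps0).
have [r2 r20 r2P] : exists2 r, 0 < r & forall x, t1 <= L x <= t1 -> D x <= r -> theta < G x.
  apply: (@thin_tube t1 t1 (fun x => theta < G x)) => t tt.
  have -> : t = t1 by apply/eqP; rewrite eq_le andbC.
  have cG : {for line t1, continuous G} := potential_continuous (N := 0) smB0 (line_U t101).
  by apply: (cvgr_gt (G (line t1)) cG); rewrite G_line.
pose r := Num.min r1 r2.
have r0 : 0 < r by rewrite !lt_min r10.
have [rr1 rr2] : r <= r1 /\ r <= r2 by split; rewrite ge_min lexx ?orbT.
pose T := [set x | d <= L x <= 1 - d /\ D x <= r].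
have TP x : T x -> U x /\ `|x - line (L x)| <= eps.
  by move=> [Lx Dx]; apply: r1P => //; apply: le_trans rr1.
have TU x : T x -> U x by case/TP.
have [N N0 NP] := @large_penalty G d (1 - d) r (theta + c1) r0
  (fun x Lx Dx => potential_continuous (N := 0) smB0 (TU x (conj Lx Dx))).
pose Omega : set V := U `&` [set x | D x < r].
pose psi (x : V) : R := G x + N * D x.
have psi_line t : psi (line t) = h t by rewrite /psi D_line mulr0 addr0 G_line.
have Gpsi x : G x <= psi x by rewrite lerDl mulr_ge0 ?D_ge0.
(* Over [t1] all points of the tube lie above the level [theta]. *)
have not0 : ~ crossing Omega psi (chi \o L) L d (1 - d) theta 0.
  move=> [C [cC CX [y Cy Ly] [w Cw Lw]]].
  have Lt1 u : C u -> L u <> t1.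
    move=> /CX[[_ Du]] + Lu; rewrite mul0r addr0 => /(le_lt_trans (Gpsi u)).
    by rewrite ltNge ltW // r2P ?Lu ?lexx // (le_trans (ltW Du)).
  have [||||CL|CL] := @connected_split _ C [set u | L u < t1] [set u | t1 < L u] cC.
  - rewrite openE => u Lu; exact: (cvgr_lt _ (L_continuous (x := u))).
  - rewrite openE => u Lu; exact: (cvgr_gt _ (L_continuous (x := u))).
  - by move=> u /Lt1 /eqP; rewrite neq_lt => /orP[]; [left | right].
  - by move=> u _ /= /ltW; rewrite leNgt => /negP.
  - by have := CL w Cw; rewrite /= ltNge (le_trans (ltW t1d')).
  - by have := CL y Cy; rewrite /= ltNge (le_trans Ly) // ltW.
have all1 : crossing Omega psi (chi \o L) L d (1 - d) theta c1.
  exists (segment a b); split; first exact: line_segment_connected.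
  - move=> _ [t /= t01 <-]; rewrite -/(line t); split.
      by split; [exact: line_U | rewrite /= D_line].
    rewrite psi_line /= L_line.
    have [tm|tm] := boolP (2 * d <= t <= 1 - 2 * d).
      apply: (le_lt_trans (hmax t t01)); apply: (@lt_le_trans _ _ (theta + c1 * c0)).
        by rewrite -/H c1c0 /theta; lra.
      by rewrite lerD2l ler_wpM2l // c0P.
    have chi0 : 0 <= c1 * chi t by rewrite mulr_ge0 //; case/andP: (chi01 t).
    rewrite (le_lt_trans _ (lt_le_trans H2 _)) ?lerDl // hends //.
    by move: tm; rewrite negb_and -!ltNge => /orP[]/ltW; [left|right].
  - exists a; first exact: segmentl.
    by have := L_line 0; rewrite /line scale0r addr0 => ->; apply: ltW.
  - exists b; first exact: segmentr.
    by have := L_line 1; rewrite /line scale1r addrC subrK => ->; rewrite gerBl ltW.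
have [|||||||||c [x [c01 [Ox Lx] psix nreg]]] :=
  @mountain_pass R V Omega T psi (chi \o L) L d (1 - d) theta c1 _ _ _ _ _ _ _ _ _ not0 all1.
- apply: openI => //; rewrite openE => x Dx.
  exact: (cvgr_lt _ (D_continuous (x := x))).
- move=> x xOT; have Ux : U x by case: xOT => [[]|/TU].
  apply: cvgD; first exact: potential_continuous.
  by apply: cvgM; [exact: cvg_cst | exact: D_continuous].
- by move=> x; apply: continuous_comp; [exact: L_continuous | exact: smooth_continuous].
- by move=> x; apply: chi01.
- by move=> x; apply: chi_out.
- exact: tube_compact.
- by move=> x [_ Dx] Lx; split=> //; apply: ltW.
- by move=> x [].
- move=> x Tx nO; have [Lx Dx] := Tx.
  have Dr : D x = r.
    apply/eqP; rewrite eq_le Dx leNgt; apply/negP => lt; apply: nO.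
    by split=> //; apply: TU.
  apply: le_lt_trans (NP x Lx Dr); rewrite lerD2l -[leRHS]mulr1 ler_wpM2l //.
  by case/andP: (chi01 (L x)).
pose B (t : R^o) : R^o := (- m) * t + (- c) * chi t.
have smB : smooth_expr B.
  by apply: smooth_add; apply: smooth_mul => //; [exact: smooth_cst|exact: smooth_id|exact: smooth_cst].
have dB (t : R) : is_derive t 1 (B : R -> R) (- m + - c * dchi t).
  have := dchiP t => dt; apply: is_derive_eq.
  by rewrite /GRing.scale /=; ring.
have [Ux Dx] := Ox.
(* [psi < theta + c * chi] is a sublevel set of the test function of [B]. *)
have testE y : eta0 (f y) + test N B y = psi y - c * chi (L y) + eta0 (f a).
  by rewrite /test /B /psi /G /test /B0; ring.
have below y : (eta0 (f y) + test N B y < eta0 (f x) + test N B x) = (psi y < theta + c * chi (L y)).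
  by rewrite !testE psix /= addrK ltrD2r ltrBlDr.
have nearO : nbhs x Omega.
  apply: filterI; first exact: open_nbhs_nbhs.
  exact: (cvgr_lt _ (D_continuous (x := x))).
have [_ xline] := TP x (conj Lx (ltW Dx)).
exists x, ('d (test N B) x); split=> //.
- rewrite (diff_test_line N smB (dB (L x))) addrAC addNr add0r mulNr normrN normrM.
  case/andP: c01 => c_ge0 c_le1; rewrite ger0_norm // (le_trans _ c1M) // ler_pM //.
  by apply/MP/strip.
- move=> prop; apply: nreg; split.
  + move=> A xA.
    have [y [[Ay Oy] Uy]] := graph_propagates_near openU contf cont_eta0
      (smooth_test_line N smB) Ux prop (filterI xA nearO).
    by rewrite below => lt; exists y.
  + move=> S S' oS oS' cov disj.
    have [||sideS|sideS] := graph_propagates_side openU contf cont_eta0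
      (smooth_test_line N smB) Ux prop nearO oS oS'.
    * by move=> y Oy Uy; rewrite below => lt; apply: cov.
    * by move=> y _ _ _; apply: disj.
    * left; apply: (@filterS _ (nbhs x) _ _ _ _ sideS) => y side [[Uy _] lt].
      by apply: side => //; rewrite below.
    * right; apply: (@filterS _ (nbhs x) _ _ _ _ sideS) => y side [[Uy _] lt].
      by apply: side => //; rewrite below.
Qed.

End LineDeformation.
Section ApproximateCriticalPoint.
Variables (k : comNzRingType) (R : realType) (V W : normedModType R).
Variables (U : set V) (f : V -> W) (a b : V) (eta0 : dual W).
Hypotheses (openU : open U) (contf : {within U, continuous f}).
Hypotheses (fV : finite_dim V) (cont_eta0 : continuous eta0).
Hypotheses (neq_ab : a <> b) (abU : segment a b `<=` U).

(** Along the segment, [eta0 \o f] minus its affine interpolation vanishes at both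
    ends: if it is positive somewhere it has a positive interior maximum, and
    otherwise an interior minimum, which is taken at 1/2 when it vanishes
    identically. *)
Lemma approximate_critical_points : exists alpha beta : R,
  [/\ 0 < alpha, beta < 1 & forall eps, 0 < eps -> exists t x (xi : dual V),
    [/\ alpha <= t <= beta, U x, `|x - (a + t *: (b - a))| <= eps,
      `|xi (b - a) + eta0 (f b - f a)| <= eps
      & ~ propagates (const_sheaf k (U `*` setT) (graph_on U f)) (x, f x)
            (dual_pair xi eta0)]].
Proof.
have v0 : b - a <> 0 by move=> /subr0_eq/esym.
have [l [q [lv cl smq [q_ge0 q_line q0 q_eq0 lqc]]]] := line_coordinates fV v0.
pose line (t : R) : V := a + t *: (b - a).
pose h (t : R) : R := eta0 (f (line t)) - eta0 (f a) - t * eta0 (f b - f a).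
have h0 : h 0 = 0 by rewrite /h /line scale0r addr0 mul0r subrr subr0.
have line1 : line 1 = b by rewrite /line scale1r addrC subrK.
have h1 : h 1 = 0 by rewrite /h line1 mul1r linearB subrr.
have ch (t : R) : 0 <= t <= 1 -> {for t, continuous h}.
  move=> t01; apply: cvgB.
    apply: cvgB; last exact: cvg_cst.
    apply: (@continuous_comp _ _ _ line (fun x => eta0 (f x))).
      exact: segment_continuous.
    by apply: (eta_f_continuous openU contf cont_eta0); apply: abU; exists t.
  by apply: cvgM; [exact: cvg_id | exact: cvg_cst].
have ch01 : {within `[0, 1], continuous h}.
  by apply: continuous_in_subspaceT => t; rewrite inE /= in_itv; apply: ch.
have [[t tP]|hle] := pselect (exists t, 0 <= t <= 1 /\ 0 < h t).
- have [t1] := EVT_max ler01 ch01; rewrite in_itv /= => t101 hmax.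
  have H0 : 0 < h t1 by case: tP => t01 /lt_le_trans; apply; apply: hmax; rewrite in_itv.
  have small s : 0 <= s <= 1 -> h s = 0 -> \forall u \near s, h u < h t1 / 2.
    by move=> s01 hs; apply: (cvgr_lt _ (ch s s01)); rewrite hs divr_gt0.
  have /nbhs_ballP[r r0 rP] := small 0 (introT andP (conj (lexx 0) ler01)) h0.
  have /nbhs_ballP[r' r'0 r'P] := small 1 (introT andP (conj ler01 (lexx 1))) h1.
  pose d := Num.min (Num.min (r / 3) (r' / 3)) (1 / 4).
  have d0 : 0 < d by rewrite !lt_min !divr_gt0.
  have [dr dr' d4] : [/\ d <= r / 3, d <= r' / 3 & d <= 1 / 4].
    by split; rewrite !ge_min lexx ?orbT.
  exists d, (1 - d); split=> //; first lra.
  move=> eps e0.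
  have [|||x [xi [Ux Lx xL xiv np]]] := approx_max k openU contf cont_eta0 abU
    lv cl smq q_ge0 q_line q0 q_eq0 lqc t101 H0 e0 d0; first lra.
  + by move=> t' t'01; apply: hmax; rewrite in_itv.
  + move=> u /andP[u0 u1] [ud|ud]; apply: ltW.
    * by apply: rP; rewrite -ball_normE /= sub0r normrN ger0_norm //; lra.
    * by apply: r'P; rewrite -ball_normE /= ger0_norm; lra.
  by exists (l (x - a)), x, xi.
- have [t0 [t00 t01 hmin]] : exists t0, [/\ 0 < t0, t0 < 1 & forall t, 0 <= t <= 1 -> h t0 <= h t].
    have [t0] := EVT_min ler01 ch01; rewrite in_itv /= => t001 hmin'.
    have hmin t : 0 <= t <= 1 -> h t0 <= h t by move=> t01; apply: hmin'; rewrite in_itv.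
    have [ht|ht] := eqVneq (h t0) 0.
      exists (1 / 2); split; [lra | lra |] => t t01.
      rewrite (le_trans _ (hmin t t01)) // ht leNgt; apply/negP => hh.
      by apply: hle; exists (1 / 2); split=> //; apply/andP; split; lra.
    exists t0; have /andP[t00 t01] := t001; split=> //.
      by rewrite lt_neqAle t00 andbT; apply: contra_neq ht => <-.
    by rewrite lt_neqAle t01 andbT; apply: contra_neq ht => ->.
  pose d0 := Num.min t0 (1 - t0) / 2.
  have [d00 d0l d0r] : [/\ 0 < d0, 2 * d0 <= t0 & 2 * d0 <= 1 - t0].
    have min0 : 0 < Num.min t0 (1 - t0) by rewrite lt_min t00 subr_gt0.
    split; rewrite /d0; first by rewrite divr_gt0.
      by rewrite mulrC divfK // ge_min lexx.
    by rewrite mulrC divfK // ge_min lexx orbT.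
  exists (t0 - d0), (t0 + d0); split; [lra | lra |] => eps e0.
  pose d := Num.min d0 (eps / 2).
  have dpos : 0 < d by rewrite lt_min d00 divr_gt0.
  have [dd0 de] : d <= d0 /\ d <= eps / 2 by split; rewrite ge_min lexx ?orbT.
  have [||||x [xi [Ux Lx xL xiv np]]] := approx_min k openU contf cont_eta0 abU
    lv cl smq q_ge0 q_line q0 q_eq0 lqc dpos (t0 := t0) (eps := eps); [lra | lra | lra | |].
    exact: hmin.
  exists (l (x - a)), x, xi; split=> //.
  case/andP: Lx => L1 L2; apply/andP; split.
    by rewrite (le_trans _ L1) // lerD2l lerN2.
  by rewrite (le_trans L2) // lerD2l.
Qed.

End ApproximateCriticalPoint.
(** * Limits of covectors *)

Section Cone.
Variables (k : comNzRingType) (R : realType) (E : normedModType R).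

(** The two functions have the same Taylor expansion of order one. *)
Lemma near_eq_differentiable (f g : E -> R^o) (x : E) :
  {near x, f =1 g} -> differentiable f x -> differentiable g x.
Proof.
move=> fg /diff_locallyP[cdf /eqaddoP df].
have gE : g \o shift x = cst (g x) + 'd f x +o_ 0 id.
  apply/eqaddoP => e e0; have {}df := df e e0.
  have shift0 : (h + x) @[h --> (0 : E)] --> x.
    by rewrite -[X in _ --> X]add0r; apply: cvgD; [exact: cvg_id | exact: cvg_cst].
  have near0 : \forall h \near (0 : E), f (h + x) = g (h + x) := shift0 _ fg.
  apply: (@filterS2 _ (nbhs (0 : E)) _ _ _ _ _ df near0) => h.
  have fgx : f x = g x := nbhs_singleton fg.
  rewrite -[(_ - _) h in X in X -> _]/(f (h + x) - (f x + 'd f x h)).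
  rewrite -[(_ - _) h in X in _ -> X]/(g (h + x) - (g x + 'd f x h)).
  by rewrite fgx => + <-.
apply/diff_locallyP.
by rewrite (diff_unique cdf gE).
Qed.

Lemma scale_smooth_on (N : set E) (phi : E -> R^o) (s : R) : open N -> smooth_on N phi ->
  smooth_on N (s \*: phi).
Proof.
move=> oN sm vs x Nx.
pose D := foldr (fun v (g : E -> R^o) => 'D_v g).
have DE us y : N y -> D (s \*: phi) us y = s *: D phi us y.
  elim: us y => //= v us IH y Ny.
  rewrite (@near_eq_derive _ _ _ _ (s \*: D phi us)).
    by rewrite deriveZ //; apply: diff_derivable; exact: sm.
  by apply: (@filterS _ (nbhs y) _ N) => [z /IH//|]; apply: open_nbhs_nbhs.
apply: (@near_eq_differentiable (s \*: D phi vs)).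
  by apply: (@filterS _ (nbhs x) _ N) => [y /DE//|]; apply: open_nbhs_nbhs.
exact: differentiableZ (sm vs x Nx).
Qed.

Variables (P : set E) (F : sheaf k P).

(** A positive multiple of a test function has the same nonnegative set. *)
Lemma propagates_scale (p : E) (s : R) (xi zeta : dual E) : 0 < s ->
  (forall z, zeta z = s * xi z) -> propagates F p zeta -> propagates F p xi.
Proof.
move=> s0 zE prop N phi pN sm phip dphi.
have dphi' : differentiable phi p := sm [::] p pN.
have := prop N (s \*: phi) pN (scale_smooth_on s (open_oset N) sm) _ _.
have -> : N `&` [set q | 0 <= (s \*: phi) q] = N `&` [set q | 0 <= phi q].
  by congr (_ `&` _); apply/seteqP; split=> q /=; rewrite pmulr_rge0.
apply; first by rewrite /= phip scaler0.
by move=> z; rewrite diffZ //= dphi zE.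
Qed.

Lemma dual_scale (s : R) (xi : dual E) : exists zeta : dual E, forall z, zeta z = s * xi z.
Proof.
have zlin : linear (fun z => s * xi z : R^o).
  by move=> c x y; rewrite linearP mulrDr -![_ *: _]/(_ * _) mulrCA.
by exists (HB.pack (fun z => s * xi z : R^o) (GRing.isLinear.Build R E R^o *:%R _ zlin) : dual E).
Qed.

Lemma microsupport_scale (p : E) (s : R) (xi zeta : dual E) : 0 < s ->
  (forall z, zeta z = s * xi z) -> microsupport F (p, xi) -> microsupport F (p, zeta).
Proof.
move=> s0 zE [Pp near_p]; split=> // e e0.
have es0 : 0 < Num.min e (e / s) by rewrite lt_min e0 divr_gt0.
have [q [xi' [Pq np qp xi'E]]] := near_p _ es0.
have [zeta' z'E] := dual_scale s xi'.
exists q, zeta'; split=> //.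
- by move=> /(propagates_scale s0 z'E).
- by apply: lt_le_trans qp _; rewrite ge_min lexx.
- move=> v; rewrite /= z'E zE -mulrBr normrM gtr0_norm //.
  rewrite mulrC -ler_pdivlMr // (le_trans (xi'E v)) // mulrAC ler_wpM2r //.
  by rewrite ge_min lexx orbT.
Qed.

End Cone.

Lemma compact_limit (R : realType) (T : topologicalType) (A : set T) (P : R -> set T) :
    compact A -> (forall eps, 0 < eps -> exists2 z, A z & P eps z) ->
    (forall eps eps', eps <= eps' -> P eps `<=` P eps') ->
  exists2 z, A z & forall eps B, 0 < eps -> nbhs z B -> exists2 y, B y & P eps y.
Proof.
move=> cA AP Pmono.
have pos n : 0 < n.+1%:R^-1 :> R by rewrite invr_gt0 ltr0n.
pose u n := sval (cid2 (AP _ (pos n))).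
have uA n : A (u n) by rewrite /u; case: cid2.
have uP n : P n.+1%:R^-1 (u n) by rewrite /u; case: cid2.
have uAn : (u @ \oo) A by exists 0%N => // n _; exact: uA.
have [z [Az uz]] := cA (u @ \oo) _ uAn.
exists z => // eps B eps0 zB.
have uPe : \forall n \near \oo, P eps (u n).
  near=> n; have le : n.+1%:R^-1 <= eps :> R.
    by apply: ltW; near: n; exact: (near_infty_natSinv_lt (PosNum eps0)).
  exact: (Pmono _ _ le _ (uP n)).
by have [y [Py By]] := uz _ _ uPe zB; exists y.
Unshelve. all: by end_near. Qed.
Section Limit.
Variables (k : comNzRingType) (R : realType) (V W : normedModType R).
Variables (U : set V) (f : V -> W) (a b : V) (eta0 : dual W).
Hypotheses (openU : open U) (contf : {within U, continuous f}).
Hypotheses (fV : finite_dim V) (cont_eta0 : continuous eta0).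
Hypotheses (neq_ab : a <> b) (abU : segment a b `<=` U).
Local Notation m := (eta0 (f b - f a)).

Lemma continuous_form_bounded (E : normedModType R) (l : {linear E -> R^o}) :
  continuous l -> exists2 C, 0 <= C & forall x, `|l x| <= C * `|x|.
Proof.
move=> /linear_bounded_continuous/linear_boundedP/pinfty_ex_gt0[C C0 CP].
by exists C => //; apply: ltW.
Qed.

(** The approximate critical covectors [(xi', eta0)] are divided by the maximum of 1
    and of the norm of the coordinates of [xi'], so that they stay in a compact set
    and away from 0. *)
Lemma conormal_limit : exists (t s : R) (xi : dual V),
  [/\ 0 < t < 1, 0 <= s, s != 0 \/ (exists x, xi x != 0),
      xi (b - a) + s * m = 0
    & forall eta : dual W, (forall w, eta w = s * eta0 w) ->
        conormal_at k U f (a + t *: (b - a)) (xi, eta)].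
Proof.
have [alpha [beta [alpha0 beta1 approx]]] :=
  approximate_critical_points k openU contf fV cont_eta0 neq_ab abU.
have [n [e [X [eX cX]]]] := finite_dim_coordinates fV.
pose F := const_sheaf k (U `*` setT) (graph_on U f).
pose A : set (R * (R * 'rV[R]_n)) :=
  `[alpha, beta]%classic `*` (`[0, 1]%classic `*` [set w | `|w| <= 1]).
have cA : compact A.
  apply: compact_setX; first exact: segment_compact.
  apply: compact_setX; first exact: segment_compact.
  apply: bounded_closed_compact.
    by exists 1; split=> // r r1 u /= /le_trans; apply; apply: ltW.
  have -> : [set w : 'rV[R]_n | `|w| <= 1] = (fun u : 'rV[R]_n => `|u|) @^-1` [set r | r <= 1] by [].
  by apply: closed_comp => [u _|]; [exact: norm_continuous|exact: closed_le].
pose P eps := [set z : R * (R * 'rV[R]_n) | [/\ 0 < z.2.1 <= 1, `|z.2.2| = 1 \/ z.2.1 = 1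
  & exists x (xi : dual V), [/\ U x, `|x - (a + z.1 *: (b - a))| <= eps,
      `|xi (b - a) + m| <= eps, ~ propagates F (x, f x) (dual_pair xi eta0)
    & forall i, z.2.2 ord0 i = z.2.1 * xi (e i)]]].
have AP eps : 0 < eps -> exists2 z, A z & P eps z.
  move=> eps0; have [t [x [xi [tab Ux xt xiv np]]]] := approx eps eps0.
  pose u : 'rV[R]_n := \row_i xi (e i).
  pose rho := Num.max 1 `|u|.
  have rho1 : 1 <= rho by rewrite le_max lexx.
  have urho : `|u| <= rho by rewrite le_max lexx orbT.
  have rho0 : 0 < rho by apply: lt_le_trans rho1.
  have nu : `|rho^-1 *: u| = `|u| / rho by rewrite normrZ gtr0_norm ?invr_gt0 // mulrC.
  exists (t, (rho^-1, rho^-1 *: u)).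
    split; first by rewrite /= in_itv.
    split; first by rewrite /= in_itv /= invr_ge0 ltW //= invf_le1.
    by rewrite /= nu ler_pdivrMr // mul1r.
  split=> /=; first by rewrite invr_gt0 rho0 invf_le1.
    have [u1|u1] := leP `|u| 1; [right|left].
      by rewrite /rho max_l // invr1.
    by rewrite nu /rho max_r ?divff ?gt_eqF ?ltW // (lt_trans _ u1).
  by exists x, xi; split=> // i; rewrite !mxE.
have Pmono eps eps' : eps <= eps' -> P eps `<=` P eps'.
  move=> le z [z0 zn [x [xi [Ux xz xiv np we]]]]; split=> //.
  by exists x, xi; split=> //; apply: le_trans le.
have [[t [s w]] [/= tab [s01 w1]] lim] := compact_limit cA AP Pmono.
have {}lim eps : 0 < eps -> exists z : R * (R * 'rV[R]_n),
    [/\ `|t - z.1| < eps, `|s - z.2.1| < eps, `|w - z.2.2| < eps & P eps z].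
  move=> eps0; have [z zB Pz] := lim eps _ eps0 (nbhsx_ballx (t, (s, w)) eps eps0).
  by exists z; have [z1 [z2 z3]] := zB; split=> //; move: z1 z2 z3; rewrite -!ball_normE.
have xi_lin : linear (fun x => \sum_i X i x * w ord0 i : R^o).
  move=> c x y; rewrite scaler_sumr -big_split /=; apply: eq_bigr => i _.
  by rewrite linearP mulrDl -![_ *: _]/(_ * _) mulrA.
pose xi : dual V := HB.pack (fun x => \sum_i X i x * w ord0 i : R^o)
  (GRing.isLinear.Build R V R^o *:%R _ xi_lin).
have [CX CX0 CXP] : exists2 C, 0 <= C & forall x, \sum_i `|X i x| <= C * `|x|.
  have CX_ i : exists C, 0 <= C /\ forall x, `|X i x| <= C * `|x|.
    by have [C C0 CP] := continuous_form_bounded (cX i); exists C.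
  exists (\sum_i sval (cid (CX_ i))) => [|x].
    by apply: sumr_ge0 => i _; case: cid => C [].
  by rewrite mulr_suml ler_sum // => i _; case: cid => C [].
have [Ce Ce0 CeP] := continuous_form_bounded cont_eta0.
have xi_near (z : R * (R * 'rV[R]_n)) (xi' : dual V) eps x :
    `|w - z.2.2| < eps -> (forall i, z.2.2 ord0 i = z.2.1 * xi' (e i)) ->
    `|z.2.1 * xi' x - xi x| <= CX * eps * `|x|.
  move=> wz zE; rewrite [x in xi' x]eX linear_sum mulr_sumr -sumrB.
  rewrite (le_trans (ler_norm_sum _ _ _)) // mulrAC.
  apply: (@le_trans _ _ (\sum_i `|X i x| * eps)).
    apply: ler_sum => i _; have -> : xi' (X i x *: e i) = X i x * xi' (e i) by exact: linearZ.
    rewrite mulrCA -zE -mulrBr normrM.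
    rewrite ler_wpM2l // distrC (le_trans _ (ltW wz)) //.
    by have := rV_entry_le (w - z.2.2) i; rewrite !mxE.
  by rewrite -mulr_suml ler_wpM2r // (le_trans (normr_ge0 _) (ltW wz)).
move: s01; rewrite in_itv /= => /andP[s0 s1].
move: tab; rewrite in_itv /= => /andP[ta tb].
have t01 : 0 < t < 1 by rewrite (lt_le_trans alpha0) // (le_lt_trans tb).
exists t, s, xi; split=> //.
- have [s_eq0|] := eqVneq s 0; last by left.
  right; apply: contrapT => xi0.
  have xi0' x : xi x = 0.
    by apply/eqP; apply/negPn/negP => nx; apply: xi0; exists x.
  pose E0 := \sum_i `|e i|.
  have E00 : 0 <= E0 by apply: sumr_ge0.
  have CE0 : 0 <= CX * E0 by rewrite mulr_ge0.
  pose eps := (2 * (1 + CX * E0))^-1.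
  have eps0 : 0 < eps by rewrite invr_gt0 mulr_gt0 // ltr_wpDr.
  have epsE : CX * E0 * eps + eps = 1 / 2.
    by rewrite /eps; field; rewrite gt_eqF // ltr_wpDr.
  have CEeps : 0 <= CX * E0 * eps by rewrite mulr_ge0 // ltW.
  have [z [_ sz wz [/andP[z0 _] zn [x [xi' [_ _ _ _ wE]]]]]] := lim _ eps0.
  have nz2 : `|z.2.2| <= CX * E0 * eps.
    apply: rV_norm_le => // i; have := xi_near z xi' eps (e i) wz wE.
    rewrite xi0' subr0 -wE => /le_trans; apply.
    rewrite mulrAC ler_wpM2r ?(ltW eps0) // ler_wpM2l // /E0 (bigD1 i) //= lerDl.
    exact: sumr_ge0.
  have [small1 small2] : CX * E0 * eps < 1 /\ eps < 1.
    have half1 : 1 / 2 < 1 :> R by rewrite ltr_pdivrMr // mul1r ltr1n.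
    by split; apply: le_lt_trans half1; rewrite -epsE ?lerDl ?lerDr // ltW.
  case: zn => zn.
    by move: nz2; rewrite zn leNgt small1.
  by move: sz; rewrite s_eq0 sub0r normrN gtr0_norm // zn ltNge ltW.
- apply/eqP; rewrite -normr_eq0; apply/eqP; apply/le_anti; rewrite normr_ge0 andbT.
  pose C := CX * `|b - a| + `|m| + 1.
  have C0 : 0 < C by rewrite ltr_pwDr // addr_ge0 // mulr_ge0.
  apply/ler_addgt0Pr => d d0; rewrite add0r.
  have eps0 : 0 < d / C by rewrite divr_gt0.
  have [z [_ sz wz [/andP[z0 z1] zn [x [xi' [_ _ xiv _ wE]]]]]] := lim _ eps0.
  have -> : xi (b - a) + s * m = - (z.2.1 * xi' (b - a) - xi (b - a)) +
      (z.2.1 * (xi' (b - a) + m) + (s - z.2.1) * m) by ring.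
  rewrite (le_trans (ler_normD _ _)) // normrN.
  apply: (@le_trans _ _ (CX * (d / C) * `|b - a| + (d / C + d / C * `|m|))).
    apply: lerD; first exact: xi_near.
    rewrite (le_trans (ler_normD _ _)) // lerD // normrM.
      by rewrite gtr0_norm // -[leRHS]mul1r ler_pM // ltW.
    by rewrite ler_wpM2r // ltW.
  have -> : CX * (d / C) * `|b - a| + (d / C + d / C * `|m|) = d / C * C by rewrite /C; ring.
  by rewrite divfK // gt_eqF.
- move=> eta etaE; have tw : 0 <= t <= 1 by case/andP: t01 => ? ?; rewrite !ltW.
  split; first by split=> //; apply: abU; exists t.
  move=> d d0 /=; set c := a + t *: (b - a).
  have Uc : U c by apply: abU; exists t.
  have /cvgrPdist_lt/(_ d d0) := open_continuous_at openU contf Uc.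
  move=> /nbhs_ballP[r r0 rP].
  pose eps := Num.min (Num.min d r / (2 * (1 + `|b - a|))) (d / (CX + Ce + 1)).
  have dr0 : 0 < Num.min d r by rewrite lt_min d0.
  have v1 : 0 < 1 + `|b - a| by rewrite ltr_wpDr.
  have C1 : 0 < CX + Ce + 1 by rewrite ltr_wpDl // addr_ge0.
  have eps0 : 0 < eps by rewrite lt_min !divr_gt0 // mulr_gt0.
  have eps1 : eps * (1 + `|b - a|) < Num.min d r.
    have : eps <= Num.min d r / (2 * (1 + `|b - a|)) by rewrite ge_min lexx.
    rewrite ler_pdivlMr ?mulr_gt0 // => le; rewrite -(ltr_pM2l (ltr0n R 2)) mulrCA.
    by rewrite (le_lt_trans le) // mulr2n mulrDl mul1r ltrDl.
  have eps2 : (CX + Ce) * eps <= d.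
    have : eps <= d / (CX + Ce + 1) by rewrite ge_min lexx orbT.
    rewrite ler_pdivlMr // => /(le_trans _); apply.
    by rewrite mulrC ler_wpM2l ?(ltW eps0) // lerDl.
  have [z [tz sz wz [/andP[z0 z1] zn [x [xi' [Ux xz _ np wE]]]]]] := lim _ eps0.
  have xc : `|x - c| < Num.min d r.
    apply: le_lt_trans eps1.
    have -> : x - c = (x - (a + z.1 *: (b - a))) - (t - z.1) *: (b - a).
      by rewrite /c scalerBl opprB [in RHS]opprD !addrA subrK opprD addrA.
    rewrite (le_trans (ler_normB _ _)) // mulrDr mulr1 lerD // normrZ ler_wpM2r //.
    exact: ltW.
  have [zeta zetaE] := dual_scale z.2.1 (dual_pair xi' eta0).
  exists (x, f x), zeta; split.
  + by [].
  + by move=> /(propagates_scale z0 zetaE).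
  + rewrite prod_normE /= gt_max; apply/andP; split.
      by apply: lt_le_trans xc _; rewrite ge_min lexx.
    rewrite distrC; apply: rP; rewrite -ball_normE /= distrC.
    by apply: lt_le_trans xc _; rewrite ge_min lexx orbT.
  + move=> [y y']; rewrite zetaE -[dual_pair xi' eta0 _]/(xi' y + eta0 y').
    rewrite -[dual_pair xi eta _]/(xi y + eta y') etaE.
    have -> : z.2.1 * (xi' y + eta0 y') - (xi y + s * eta0 y') =
      (z.2.1 * xi' y - xi y) - (s - z.2.1) * eta0 y' by ring.
    rewrite (le_trans (ler_normB _ _)) //.
    have [ny ny'] : `|y| <= `|(y, y')| /\ `|y'| <= `|(y, y')|.
      by rewrite prod_normE /= !le_max !lexx orbT.
    apply: (@le_trans _ _ (CX * eps * `|(y, y')| + eps * (Ce * `|(y, y')|))).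
      apply: lerD.
        by rewrite (le_trans (xi_near z xi' eps y wz wE)) // ler_wpM2l // mulr_ge0 // ltW.
      rewrite normrM ler_pM // ?(ltW sz) // (le_trans (CeP y')) // ler_wpM2l //.
    rewrite mulrA -mulrDl ler_wpM2r // [eps * Ce]mulrC -mulrDl.
    exact: eps2.
Qed.

End Limit.

Theorem theorem6p4 (k : comNzRingType) (R : realType)
    (V W : normedModType R) (U : set V) (f : V -> W) (a b : V)
    (eta0 : dual W)
    (gldim_k : finite_gldim k)
    (dimV : finite_dim V) (dimW : finite_dim W)
    (openU : open U)
    (contf : {within U, continuous f})
    (aU : U a) (bU : U b) (neq_ab : a <> b)
    (abU : segment a b `<=` U)
    (eta0_neq0 : ~ (forall w, eta0 w = 0)) :
  exists c : V,
    [/\ open_segment a b c,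
        (conormal_at_dir k U f c eta0 `\` zero_covector (W := W))
          `&` annihilator_pair (b - a) (f b - f a) !=set0
      & lipschitz_at_for k U f (annihilator (b - a)) c ->
        exists xi0 : dual V,
          (conormal_at k U f c `&` annihilator_pair (b - a) (f b - f a))
            (xi0, eta0)].
Proof.
have cont_eta0 : continuous eta0 := finite_dim_form_continuous dimW.
have [t [s [xi [t01 s0 nz orth lim]]]] :=
  conormal_limit k openU contf dimV cont_eta0 neq_ab abU.
have [eta etaE] := dual_scale s eta0.
have con := lim eta etaE.
have nzero : ~ zero_covector (xi, eta).
  move=> [xi0 eta_0]; case: nz => [/eqP sN0|[x]]; last by rewrite xi0 eqxx.
  apply: eta0_neq0 => w; have /eqP := eta_0 w; rewrite /= etaE mulf_eq0.
  by move=> /orP[/eqP|/eqP].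
exists (a + t *: (b - a)); split; first by exists t.
  exists (xi, eta); split; last first.
    by rewrite /annihilator_pair /annihilator /= /dual_pair_fun /= etaE.
  by split=> //; split=> //; exists s.
move=> lip.
have s_neq0 : s != 0.
  apply/negP => /eqP s_eq0; apply: nzero; apply: lip; split=> //=.
  split; last by move=> w; rewrite etaE s_eq0 mul0r.
  by move: orth; rewrite s_eq0 mul0r addr0.
have spos : 0 < s by rewrite lt_neqAle eq_sym s_neq0.
have [xi0 xi0E] := dual_scale s^-1 xi.
exists xi0; split.
  apply: (@microsupport_scale _ _ _ _ _ _ s^-1 _ _ _ _ con); first by rewrite invr_gt0.
  move=> [y w] /=; rewrite /dual_pair_fun /= xi0E etaE mulrDr mulrA mulVf //.
  by rewrite mul1r.
rewrite /annihilator_pair /annihilator /= /dual_pair_fun /= xi0E.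
by apply: (mulfI s_neq0); rewrite mulrDr mulrA mulfV // mul1r mulr0.
Qed.
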